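(* Let $n\ge 2$, $w\in\mathbb{C}\setminus\{0\}$, $\lambda\in\mathbb{C}$ with $0<|\lambda|<1$, $\xi_n=\exp(2\pi \mathrm{i}/n)$, and let $A$ be the attractor of the IFS $\{f_j\}_{j=0}^{n-1}$, $f_j(z)=\lambda z+\xi_n^j w$. Let $\phi$ and $\alpha$ be such that $\arg(\lambda)=2\pi\phi$ and $\arg(\xi_n)=2\pi\alpha$. (I) If $\phi=p/q\in\mathbb{Q}$ with coprime integers $p$ and $q$, let $b$ be such that $bn=\operatorname{lcm}(n,q)$, and set $d=\gcd(n,q)$. Define $$\Theta=\left\{k\phi+\left(m+\tfrac12\right)\alpha \;:\; 0\le k\le b-1,\ 0\le m\le n-1\right\}.$$ Then: (1) the convex hull of $A$ is a polygon with $nb$ sides at the angles of $\Theta$. (2) The set of extreme points of $A$ is the unique vector of non-empty compact sets $\{B_j\}_{j=0}^{nb-1}$ which solves the following system of equations: for each $0\le m\le n-1$, $$B_{mb}=f_m(B_{mb-np/d})\cup f_{m+1}(B_{mb-np/d}),\qquad B_k=f_{m+1}(B_{k-np/d})\quad\text{for } mb<k<(m+1)b,$$ where the indices of the sets are considered modulo $nb$ and those of the maps modulo $n$. (3) If the attractor $A$ is convex, then $|\lambda|\ge 2^{-1/b}$ and the system of equations in (2) describes the points on the boundary of $A$. (II) If $\phi\notin\mathbb{Q}$, then: (1) the convex hull of $A$ does not have finitely many sides; (2) the attractor $A$ is not convex.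
   Context: The attractor $A$ of the IFS (iterated function system) $\{f_j\}$ is the unique non-empty compact set with $A=\bigcup_{j=0}^{n-1} f_j(A)$. ''Extreme point of $A$'' is used in the extended sense that includes all points of $A\cap\partial\operatorname{conv}(A)$, where $\operatorname{conv}(A)$ is the convex hull of $A$, not only genuine vertices. In (2), the set of extreme points is presented as a vector (list) of sets, each $B_j$ being the set of extreme points lying on one side of $\operatorname{conv}(A)$. Angles are measured in turns (fractions of $2\pi$, modulo $1$), and a side is ''at angle $\theta$'' if its outward normal vector has argument $2\pi\theta$.
   Formalization: In (I)(1) the sides are at angles ω+θ, θ∈Θ, where arg(w)=2πω: as printed (angles θ) the claim fails for general w, e.g. n=2, λ=1/2, w=i, where A=[−2i,2i] has normals at 0, 1/2 but Θ={1/4,3/4}. For w>0 it is as printed. α is taken in [0,1), i.e. α=1/n. *)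

(* Defs.v *)
From HB Require Import structures.
From mathcomp Require Import all_boot all_order all_algebra.
From mathcomp Require Import complex.
From mathcomp Require Import all_classical all_reals all_analysis.
Import Order.TTheory GRing.Theory Num.Theory.
Import numFieldNormedType.Exports.

Set Implicit Arguments.
Unset Strict Implicit.
Unset Printing Implicit Defensive.

Local Open Scope classical_set_scope.
Local Open Scope ring_scope.
Local Open Scope complex_scope.

(** The usual metric topology of the plane. *)
HB.instance Definition _ (R : realType) := NormedModule.copy R[i] (R[i]^o).

Section Turns.
Variable R : realType.
Implicit Types (t s : R) (z : R[i]).

(** [exp (2 pi i t)], for [t] measured in turns. *)
Definition cis_turn t : R[i] :=
  (cos (2 * pi * t)) +i* (sin (2 * pi * t)).

(** [arg z = 2 pi t], modulo [2 pi]; for [z != 0] this determines [t] modulo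
    [1]. *)
Definition turn_arg z t : Prop := z = `|z| * cis_turn t.

Definition eq_turn s t : Prop := exists k : int, s - t = k%:~R.

End Turns.

Section IFS.
Variable R : realType.
Implicit Types (A K : set R[i]).

Definition xi (n : nat) : R[i] := cis_turn (n%:R^-1 : R).

Definition ifs_map (n : nat) (w lam : R[i]) (j : nat) (z : R[i]) : R[i] :=
  lam * z + xi n ^+ j * w.

Definition is_attractor (n : nat) (f : nat -> R[i] -> R[i]) A : Prop :=
  [/\ A !=set0, compact A & A = \bigcup_(j in `I_n) (f j @` A)].

End IFS.

Section PlaneConvexity.
Variable R : realType.
Implicit Types (A K V : set R[i]) (t : R).

(** [Rcomplex R] is [R[i]] seen as a real vector space: the coefficients of the
    convex combinations are real. *)
Definition is_convex A : Prop := @convex_set R (Rcomplex R) A.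

Definition conv_hull A : set R[i] :=
  \bigcap_(K in [set K | is_convex K /\ A `<=` K]) K.

Definition boundary A : set R[i] := closure A `\` interior A.

(** All the points of [A] on the boundary of its convex hull, and not only the
    vertices of the hull. *)
Definition extreme_points A : set R[i] := A `&` boundary (conv_hull A).

(** Degenerate polygons are allowed: for [n = 2] and real [lam] the hull of the
    attractor is a segment. *)
Definition is_polygon K : Prop :=
  exists V, finite_set V /\ K = conv_hull V.

(** The points of [K] which are extremal in the direction [cis_turn t]; the
    real scalar product of [y] and [u] is [complex.Re (y * conjc u)]. *)
Definition face K t : set R[i] :=
  [set z | K z /\ forall y, K y ->
    complex.Re (y * conjc (cis_turn t)) <= complex.Re (z * conjc (cis_turn t))].

(** [K] has a side with outward normal [cis_turn t]: the face in that direction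
    is not reduced to a point. *)
Definition has_side K t : Prop :=
  exists x y, [/\ face K t x, face K t y & x <> y].

(** Sides are counted through their outward normals, each normal being
    represented by its angle in [0, 1[. A segment thus has two sides (two
    opposite normals, with the same face). *)
Definition side_angles K : set R :=
  [set t | (0 <= t < 1) /\ has_side K t].

End PlaneConvexity.

Section System.
Variable R : realType.

Definition Theta (n b : nat) (phi alpha : R) : set R :=
  [set t | exists k m : nat, [/\ (k < b)%N, (m < n)%N &
    t = k%:R * phi + (m%:R + 2^-1) * alpha]].

(** The representative of [k] modulo [N] in [0, N[. *)
Definition idx (N : nat) (k : int) : nat := `|(k %% N%:Z)%Z|%N.

(** A vector of [n * b] sets is a function on [nat] of which only the values
    below [n * b] matter; [s] is the shift [n p / d] of the indices. *)
Definition solves_system (n b : nat) (s : int) (f : nat -> R[i] -> R[i])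
    (B : nat -> set R[i]) : Prop :=
  forall m : nat, (m < n)%N ->
    B (m * b)%N =
      (f m @` B (idx (n * b) ((m * b)%N%:Z - s)))
      `|` (f (m.+1 %% n)%N @` B (idx (n * b) ((m * b)%N%:Z - s)))
    /\ forall k : nat, (m * b < k < m.+1 * b)%N ->
         B k = f (m.+1 %% n)%N @` B (idx (n * b) (k%:Z - s)).

Definition nonempty_compacts (N : nat) (B : nat -> set R[i]) : Prop :=
  forall j : nat, (j < N)%N -> B j !=set0 /\ compact (B j).

(** The extreme points of [A] on the [j]-th side of its convex hull. The
    elements of [Theta] modulo [1] are the [alpha / 2 + j * alpha / b] for
    [0 <= j < n * b], so that the sides are numbered counterclockwise from the
    one at angle [omega + alpha / 2], where [omega] is the angle of [w]. *)
Definition side_points (b : nat) (omega alpha : R) (A : set R[i]) (j : nat) :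
    set R[i] :=
  extreme_points A
  `&` face (conv_hull A) (omega + alpha / 2 + j%:R * alpha / b%:R).

End System.

(* Main.v *)
(** The face of [A] in a direction is the union of the images [f_j] of the face
    in the direction turned by [- phi], over the digits [xi^j w] that are extremal
    in that direction. Two digits tie exactly when the direction bisects them, so a
    side appears exactly at the directions that some iterate of this shift brings
    onto a bisector: if no iterate does, two points of the face would be images of
    points of [A] arbitrarily far apart. For rational [phi], the recursion closes up
    on [n b] faces and is the system of the theorem; contraction gives uniqueness.
    Since [lam^b] is [|lam|^b] times a rotation of order dividing [n], the hull is
    that of the finite set of sums [(1 - |lam|^b)^-1 * sum_(i < b) lam^i xi^(j_i) w],
    and each of its sides carries a Cantor-like set of ratio [|lam|^b], which is an
    interval only if [|lam|^b >= 1/2]. For irrational [phi] the face at the first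
    bisector consists of exactly two points, so [A] cannot be convex. *)
Require Import Defs.
From HB Require Import structures.
From mathcomp Require Import all_boot all_order all_algebra.
From mathcomp Require Import complex.
From mathcomp Require Import all_classical all_reals all_analysis.
From mathcomp Require Import ring lra zify.
Import Order.TTheory GRing.Theory Num.Theory.
Import numFieldNormedType.Exports.
Import ComplexField.Normc.

Local Open Scope classical_set_scope.
Local Open Scope ring_scope.
Local Open Scope complex_scope.

(** * The Euclidean plane and contractions *)

Section Plane.
Context {R : realType}.
Implicit Types (x y z u v c : R[i]) (K Y : set R[i]).

Definition dot u z : R := complex.Re (z * conjc u).

Lemma normE z : `|z| = (normc z)%:C.
Proof. by case: z => a b; rewrite normc_def. Qed.

Lemma normc_ge0 z : 0 <= normc z.
Proof. by case: z => a b; rewrite sqrtr_ge0. Qed.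

Lemma normc_sqr z : normc z ^+ 2 = complex.Re z ^+ 2 + complex.Im z ^+ 2.
Proof. by case: z => a b; rewrite sqr_sqrtr// addr_ge0// sqr_ge0. Qed.

Lemma ler_normcD x y : normc (x + y) <= normc x + normc y.
Proof. exact: le_normcD. Qed.

Lemma normc_opp z : normc (- z) = normc z.
Proof. by case: z => a b /=; rewrite !sqrrN. Qed.

Lemma normcBC x y : normc (x - y) = normc (y - x).
Proof. by rewrite -normc_opp opprB. Qed.

Lemma normcX z k : normc (z ^+ k) = normc z ^+ k.
Proof.
by elim: k => [|k IH]; rewrite ?expr0 ?normc1// !exprS normcM IH.
Qed.

Lemma normc_gt0 z : (0 < normc z) = (z != 0).
Proof.
rewrite lt_neqAle normc_ge0 andbT eq_sym; congr (~~ _).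
by apply/eqP/eqP => [/eq0_normc//|->]; rewrite normc0.
Qed.

Lemma normc_real (r : R) : normc r%:C = `|r|.
Proof. by rewrite /= expr0n addr0 sqrtr_sqr. Qed.

Lemma dotE u z : dot u z =
  complex.Re z * complex.Re u + complex.Im z * complex.Im u.
Proof. by case: z u => [a b] [c d]; rewrite /dot/=; ring. Qed.

Lemma dotD u x y : dot u (x + y) = dot u x + dot u y.
Proof. by rewrite !dotE; case: x y => [? ?] [? ?] /=; ring. Qed.

Lemma dotN u x : dot u (- x) = - dot u x.
Proof. by rewrite !dotE; case: x => [? ?] /=; ring. Qed.

Lemma dotB u x y : dot u (x - y) = dot u x - dot u y.
Proof. by rewrite dotD dotN. Qed.

Lemma dotZ u (r : R) x : dot u (r%:C * x) = r * dot u x.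
Proof. by rewrite !dotE; case: x => [? ?] /=; ring. Qed.

Lemma dotC u x : dot u x = dot x u.
Proof. by rewrite !dotE; ring. Qed.

Lemma dotxx x : dot x x = normc x ^+ 2.
Proof. by rewrite dotE normc_sqr; ring. Qed.

Lemma dot_mul c u z : dot u (c * z) = dot (conjc c * u) z.
Proof. by rewrite !dotE; case: c u z => [? ?] [? ?] [? ?] /=; ring. Qed.

Lemma dot_le u z : dot u z <= normc u * normc z.
Proof.
have [h|h] := leP (dot u z) 0.
  by rewrite (le_trans h)// mulr_ge0// normc_ge0.
rewrite -ler_sqr ?nnegrE ?mulr_ge0 ?normc_ge0 ?(ltW h)//.
rewrite exprMn !normc_sqr dotE -subr_ge0.
rewrite [leRHS](_ : _ = (complex.Re z * complex.Im u
  - complex.Im z * complex.Re u) ^+ 2) ?sqr_ge0//.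
by ring.
Qed.

Lemma dot_le_norm u z : `|dot u z| <= normc u * normc z.
Proof.
rewrite ler_norml dot_le andbT lerNl -dotN.
by rewrite (le_trans (dot_le _ _))// normc_opp.
Qed.

Lemma nbhs_normcP z (U : set R[i]) :
  nbhs z U <-> exists2 e : R, 0 < e & forall y, normc (z - y) < e -> U y.
Proof.
split.
  move=> /nbhs_ballP[e /= e0 eU].
  have er : e = (complex.Re e)%:C.
    by move: e0; case: e {eU} => a b; rewrite ltcE/= => /andP[/eqP ->].
  exists (complex.Re e); first by move: e0; rewrite er -[0]/(0%:C) ltcR.
  by move=> y zy; apply: eU; rewrite /ball/= normE er ltcR.
move=> [e e0 eU]; apply/nbhs_ballP; exists e%:C.
  by rewrite /= -[0]/(0%:C) ltcR.
by move=> y; rewrite /ball/= normE ltcR; exact: eU.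
Qed.

Lemma closed_approx K z : closed K ->
  (forall e : R, 0 < e -> exists2 y, K y & normc (z - y) < e) -> K z.
Proof.
move=> cK H; apply: cK => U /nbhs_normcP[e e0 eU].
by have [y Ky zy] := H e e0; exists y; split => //; apply: eU.
Qed.

Lemma lipschitz_continuous_real (f : R[i] -> R) (L : R) :
  (forall x y, `|f x - f y| <= L * normc (x - y)) -> continuous f.
Proof.
move=> H z; apply/(@cvgrPdist_lt _ _ _ (nbhs z)) => e e0.
(* The added 1 keeps the denominator positive even when [L] is zero. *)
apply/nbhs_normcP; exists (e / (`|L| + 1)).
  by rewrite divr_gt0// ltr_wpDl.
move=> y; rewrite ltr_pdivlMr ?ltr_wpDl// => zy.
apply: le_lt_trans (H z y) _; apply: le_lt_trans zy.
rewrite mulrC ler_wpM2l ?normc_ge0//.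
by rewrite (le_trans (ler_norm L))// lerDl.
Qed.

Lemma continuous_dot u : continuous (dot u : R[i] -> R).
Proof.
apply: (@lipschitz_continuous_real _ (normc u)) => x y.
by rewrite -dotB dot_le_norm.
Qed.

Lemma continuous_normc_sub c : continuous ((fun z => normc (c - z)) : R[i] -> R).
Proof.
apply: (@lipschitz_continuous_real _ 1) => x y.
rewrite mul1r (normcBC x) (_ : y - x = (c - x) - (c - y)); last by ring.
exact: (@ler_dist_dist _ (Rcomplex R) (c - x) (c - y)).
Qed.

Lemma compact_normc_bounded K : compact K ->
  exists M : R, forall z, K z -> normc z <= M.
Proof.
move=> cK; have [->|/set0P K0] := eqVneq K set0; first by exists 0.
have [m mK Km] : exists2 m, m \in K & forall t, t \in K ->
    normc (0 - t) <= normc (0 - m).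
  apply: compact_EVT_max => //; apply: continuous_subspaceT.
  exact: continuous_normc_sub.
exists (normc m) => z Kz; have := Km z (mem_set Kz).
by rewrite !sub0r !normc_opp.
Qed.

Lemma plane_compact_closed K : compact K -> closed K.
Proof. by apply: compact_closed; exact: norm_hausdorff. Qed.

Lemma expr_lt (c e M : R) : 0 <= c < 1 -> 0 < e -> exists k, c ^+ k * M < e.
Proof.
move=> /andP[c0 c1] e0.
have : (fun k => c ^+ k * M) @ \oo --> 0 * M.
  by apply: cvgMr_tmp; apply: cvg_expr; rewrite ger0_norm.
rewrite mul0r => /cvgrPdist_lt/(_ e e0)[k _ /(_ k)]/= /(_ (leqnn k)).
rewrite sub0r normrN => h; exists k.
exact: le_lt_trans (ler_norm _) h.
Qed.

(** Turns an estimate that gains a factor [c] at each unfolding of the attractor into an exact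
    inequality. *)
Lemma expr_squeeze (c M a : R) : 0 <= c < 1 -> (forall k, a <= c ^+ k * M) ->
  a <= 0.
Proof.
move=> c01 H; rewrite leNgt; apply/negP => a0.
have [k] := @expr_lt c a M c01 a0.
by rewrite ltNge H.
Qed.

(** A point of [X i] is the image of a point of some [X j] under an affine map of ratio at most [c]
    that also sends [Y j] into [Y i]. After [k] such pullbacks the point is within [c ^+ k * M] of
    [Y i], which is closed. The index type allows whole vectors of sets; faces, the hull and
    uniqueness for the system all rest on this. *)
Lemma contraction_subset (I : Type) (X Y : I -> set R[i]) (c M : R) :
  0 <= c < 1 ->
  (forall i x y, X i x -> Y i y -> normc (x - y) <= M) ->
  (forall i, Y i !=set0 /\ closed (Y i)) ->
  (forall i x, X i x -> exists j x' mu e, [/\ X j x', x = mu * x' + e,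
     normc mu <= c & forall y, Y j y -> Y i (mu * y + e)]) ->
  forall i, X i `<=` Y i.
Proof.
move=> c01 XYM Yc H i x Xx.
have K : forall k i x, X i x ->
    exists2 y, Y i y & normc (x - y) <= c ^+ k * M.
  elim=> [|k IH] {i x Xx} i x Xx.
    have [[y Yy] _] := Yc i; exists y => //.
    by rewrite expr0 mul1r; exact: XYM Xx Yy.
  have [j [x' [mu [e [Xx' -> muc Ymu]]]]] := H i x Xx.
  have [y Yy xy] := IH j x' Xx'.
  exists (mu * y + e); first exact: Ymu.
  rewrite opprD addrACA subrr addr0 -mulrBr normcM exprS -mulrA.
  by apply: ler_pM => //; exact: normc_ge0.
apply: closed_approx; first exact: (Yc i).2.
move=> e e0; have [k ke] := @expr_lt c e M c01 e0.
by have [y Yy xy] := K k i x Xx; exists y => //; apply: le_lt_trans ke.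
Qed.

End Plane.

(** * Convex hulls and faces *)

Section Convexity.
Context {R : realType}.
Implicit Types (x y z u v c : R[i]) (A K V : set R[i]) (t : R).

Lemma complex_ext (x y : R[i]) :
  complex.Re x = complex.Re y -> complex.Im x = complex.Im y -> x = y.
Proof. by case: x y => [? ?] [? ?] /= -> ->. Qed.

Lemma is_convexP K : is_convex K <->
  forall x y t, 0 <= t <= 1 -> K x -> K y -> K (t%:C * x + (1 - t)%:C * y).
Proof.
have scaleE t x : t%:C * x = (t *: (x : Rcomplex R)).
  by case: x => a b; rewrite /GRing.scale/=; congr (_ +i* _); ring.
split.
  move=> cK x y t t01 Kx Ky; have := cK x y (Itv01 (andP t01).1 (andP t01).2).
  by rewrite !inE !scaleE; apply.
move=> H x y l; rewrite !inE => Kx Ky.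
have := H x y l%:num; rewrite !scaleE; apply => //.
by rewrite ge0 le1.
Qed.

Lemma conv_hull_convex A : is_convex (conv_hull A).
Proof.
apply/is_convexP => x y t t01 Kx Ky K [cK AK].
by move/is_convexP : (cK); apply => //; [apply: Kx|apply: Ky].
Qed.

Lemma sub_conv_hull A : A `<=` conv_hull A.
Proof. by move=> z Az K [_]; apply. Qed.

Lemma conv_hull_min A K : is_convex K -> A `<=` K -> conv_hull A `<=` K.
Proof. by move=> cK AK z; apply. Qed.

Lemma conv_hull_id A : is_convex A -> conv_hull A = A.
Proof.
by move=> cA; apply/seteqP; split; [exact: conv_hull_min|exact: sub_conv_hull].
Qed.

Lemma convex_affine_preimage K c e : is_convex K ->
  is_convex [set z | K (c * z + e)].
Proof.
move=> /is_convexP cK; apply/is_convexP => x y t t01 /= Kx Ky.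
have := cK _ _ _ t01 Kx Ky; rewrite rmorphB rmorph1.
by congr K; ring.
Qed.

Lemma dot_comb u x y t :
  dot u (t%:C * x + (1 - t)%:C * y) = t * dot u x + (1 - t) * dot u y.
Proof. by rewrite dotD !dotZ. Qed.

Lemma continuous_real_complex : continuous (fun t => t%:C : R[i]).
Proof.
move=> t U /nbhs_normcP[e e0 eU].
apply/nbhs_normP; exists e => //= s; rewrite /ball_/= => st.
by apply: eU; rewrite -rmorphB normc_real.
Qed.

Lemma continuous_real_complex_comp (T : topologicalType) (f : T -> R) p :
  {for p, continuous f} -> {for p, continuous (fun q => (f q)%:C : R[i])}.
Proof.
move=> cf; apply: continuous_comp => //; exact: continuous_real_complex.
Qed.

(** The union of the segments from [v] to [K], written as an image of a product so that compactness
    is inherited. *)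
Definition cone v K : set R[i] :=
  [set (p.1)%:C * p.2 + (1 - p.1)%:C * v | p in `[0, 1] `*` K].

Lemma compact_cone v K : compact K -> compact (cone v K).
Proof.
move=> cK; apply: continuous_compact; last first.
  by apply: compact_setX => //; exact: segment_compact.
apply: continuous_subspaceT => p.
apply: (@continuousD R[i] _ _ (fun q : R * R[i] => (q.1)%:C * q.2)
  (fun q : R * R[i] => (1 - q.1)%:C * v)).
  apply: (@continuousM R[i] _ (fun q : R * R[i] => (q.1)%:C)).
    exact/continuous_real_complex_comp/cvg_fst.
  exact: cvg_snd.
apply: (@continuousM R[i] _ (fun q : R * R[i] => (1 - q.1)%:C)).
  apply: (@continuous_real_complex_comp _ (fun q : R * R[i] => 1 - q.1)).
  by apply: continuousB; [exact: cvg_cst|exact: cvg_fst].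
exact: cvg_cst.
Qed.

Lemma convex_cone v K : is_convex K -> is_convex (cone v K).
Proof.
move=> /is_convexP cK; apply/is_convexP => a b l /andP[l0 l1].
move=> [[t x] [/= + Kx] <-] [[s y] [/= + Ky] <-] {a b}.
rewrite !in_itv/= => /andP[t0 t1] /andP[s0 s1].
(* The total weight put on [K]: if it vanishes the combination is the apex [v]; otherwise dividing
   by it gives the required point of [K]. *)
set m := l * t + (1 - l) * s.
have lt0 : 0 <= l * t by rewrite mulr_ge0.
have ls0 : 0 <= (1 - l) * s by rewrite mulr_ge0 // subr_ge0.
have m0 : 0 <= m by rewrite addr_ge0.
have m1 : m <= 1.
  have : 0 <= l * (1 - t) by rewrite mulr_ge0 ?subr_ge0.
  have : 0 <= (1 - l) * (1 - s) by rewrite mulr_ge0 ?subr_ge0.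
  by rewrite /m; lra.
have [m00|mN0] := eqVneq m 0.
  have lt00 : l * t = 0 by move: m00; rewrite /m; lra.
  have ls00 : (1 - l) * s = 0 by move: m00; rewrite /m; lra.
  exists (0, x); first by split => //=; rewrite in_itv/= lexx ler01.
  by case: x y v {Kx Ky} => [x1 x2] [y1 y2] [v1 v2]; apply: complex_ext;
    rewrite /= !(mul0r, mulr0, subr0, addr0, add0r, mul1r);
    rewrite !mulrDr !mulrA lt00 ls00; rewrite !mulrBr lt00 ls00; ring.
exists (m, (l * t / m)%:C * x + (1 - l * t / m)%:C * y).
  split; first by rewrite /= in_itv/= m0 m1.
  apply: cK => //; rewrite divr_ge0//= ler_pdivrMr ?mul1r; first by rewrite /m; lra.
  by rewrite lt_neqAle eq_sym mN0.
have -> : 1 - l * t / m = (1 - l) * s / m by rewrite /m; field.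
by case: x y v {Kx Ky} => [? ?] [? ?] [? ?]; apply: complex_ext; rewrite /=;
  move: mN0; rewrite /m => mN0; field.
Qed.

(** Adding a point to a non-empty finite set replaces the hull by the cone over it. The induction
    starts at singletons, because the cone over the empty set is empty. *)
Lemma compact_conv_hull V : finite_set V -> compact (conv_hull V).
Proof.
move=> /finite_seqP[s ->] {V}.
case: s => [|v s].
  rewrite (_ : conv_hull _ = set0); first exact: compact0.
  apply/seteqP; split => //; apply: conv_hull_min => //.
elim: s v => [|v' s IH] v.
  rewrite (_ : conv_hull _ = [set v]); first exact: compact_set1.
  apply/seteqP; split; last by move=> _ ->; apply: sub_conv_hull => /=; rewrite inE.
  apply: conv_hull_min; last by move=> z/=; rewrite inE => /eqP.
  apply/is_convexP => x y t _ -> -> /=.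
  by rewrite -mulrDl -rmorphD addrC subrK mul1r.
set K := conv_hull [set` v' :: s].
have v'K : K v' by apply: sub_conv_hull; rewrite /= inE eqxx.
rewrite (_ : conv_hull _ = cone v K); first exact/compact_cone/IH.
apply/seteqP; split.
  apply: conv_hull_min; first exact/convex_cone/conv_hull_convex.
  move=> z /=; rewrite inE => /orP[/eqP ->|zs].
    exists (0, v'); first by split => //=; rewrite in_itv/= lexx ler01.
    by rewrite /= subr0 mul0r add0r mul1r.
  exists (1, z); last by rewrite /= subrr mul0r addr0 mul1r.
  by split => /=; [rewrite in_itv/= lexx ler01|exact: sub_conv_hull].
move=> _ [[t x] [/= + Kx] <-]; rewrite in_itv/= => t01.
have /is_convexP := conv_hull_convex [set` [:: v, v' & s]]; apply => //.
  apply: conv_hull_min Kx; first exact: conv_hull_convex.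
  by move=> z/= zs; apply: sub_conv_hull; rewrite /= in_cons zs orbT.
by apply: sub_conv_hull; rewrite /= inE eqxx.
Qed.

Lemma normc_sub_comb_sqr y c x t :
  normc (y - (t%:C * x + (1 - t)%:C * c)) ^+ 2 =
  normc (y - c) ^+ 2 - 2 * t * dot (y - c) (x - c) + t ^+ 2 * normc (x - c) ^+ 2.
Proof.
rewrite !normc_sqr dotE.
by case: y c x => [? ?] [? ?] [? ?] /=; ring.
Qed.

(** The separating direction is that of [y - c0], with [c0] the point of [K] nearest to [y]: a point
    [c] with positive product against it would allow moving from [c0] towards [c] and closer to
    [y]. *)
Lemma convex_separation K y : is_convex K -> compact K -> K !=set0 -> ~ K y ->
  exists2 u, normc u = 1 & forall c, K c -> dot u c < dot u y.
Proof.
move=> /is_convexP cK kK K0 nKy.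
have [c0 /set_mem Kc0 c0min] : exists2 m, m \in K & forall c, c \in K ->
    normc (y - m) <= normc (y - c).
  apply: compact_EVT_min => //; apply: continuous_subspaceT.
  exact: continuous_normc_sub.
have yc0 : 0 < normc (y - c0).
  by rewrite normc_gt0 subr_eq0; apply/eqP => yE; apply: nKy; rewrite yE.
have H c : K c -> dot (y - c0) (c - c0) <= 0.
  move=> Kc; rewrite leNgt; apply/negP => d0.
  set D := dot _ _ in d0; set N := normc (c - c0) ^+ 2.
  have N0 : 0 <= N by rewrite sqr_ge0.
  (* A step length in []0, 1]] with [t * N < 2 * D], which makes the squared distance decrease. *)
  set t := D / (D + N).
  have DN : 0 < D + N by rewrite ltr_wpDr.
  have t0 : 0 < t by rewrite divr_gt0.
  have t1 : t <= 1 by rewrite ler_pdivrMr// mul1r lerDl.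
  have tE : t * (D + N) = D by rewrite divfK// gt_eqF.
  have := c0min _ (mem_set (cK c c0 t _ Kc Kc0)); rewrite (ltW t0) t1 => /(_ isT).
  rewrite -ler_sqr ?nnegrE ?normc_ge0// normc_sub_comb_sqr -/D -/N.
  rewrite leNgt => /negP; apply; rewrite -subr_gt0.
  rewrite (_ : _ - _ = t * (2 * D - t * N)); last by ring.
  rewrite mulr_gt0//; nra.
exists ((normc (y - c0))^-1%:C * (y - c0)).
  by rewrite normcM normc_real ger0_norm ?invr_ge0 ?normc_ge0// mulVf// gt_eqF.
move=> c Kc; rewrite dotC (dotC _ y) !dotZ ltr_pM2l ?invr_gt0//.
rewrite dotC (dotC y); have := H c Kc; rewrite dotB => h.
have : 0 < dot (y - c0) (y - c0) by rewrite dotxx exprn_gt0.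
by rewrite dotB; lra.
Qed.
End Convexity.

(** * The unit circle and angles measured in turns *)

Section Turns.
Context {R : realType}.
Implicit Types (s t : R) (z u : R[i]) (k : int).

Lemma cis_turnD s t : cis_turn (s + t) = cis_turn s * cis_turn t.
Proof.
rewrite /cis_turn mulrDr cosD sinD; apply: complex_ext; rewrite /=; ring.
Qed.

Lemma cis_turn0 : cis_turn 0 = 1 :> R[i].
Proof. by rewrite /cis_turn mulr0 cos0 sin0. Qed.

Lemma cis_turnN t : cis_turn (- t) = conjc (cis_turn t).
Proof. by rewrite /cis_turn mulrN cosN sinN. Qed.

Lemma normc_cis t : normc (cis_turn t) = 1.
Proof. by rewrite /= cos2Dsin2 sqrtr1. Qed.

Lemma cis_turnX t (j : nat) : cis_turn t ^+ j = cis_turn (j%:R * t).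
Proof.
elim: j => [|j IH]; first by rewrite mul0r cis_turn0.
by rewrite exprS IH -cis_turnD -natr1 mulrDl mul1r addrC.
Qed.

Lemma cis_turn_nat (j : nat) : cis_turn j%:R = 1 :> R[i].
Proof.
rewrite -[j%:R]mulr1 -cis_turnX /cis_turn mulr1 mulrC mulr_natr cos2pi sin2pi.
exact: expr1n.
Qed.

Lemma cis_turn_int k : cis_turn k%:~R = 1 :> R[i].
Proof.
case: k => j; first exact: cis_turn_nat.
by rewrite NegzE mulrNz cis_turnN cis_turn_nat conjc1.
Qed.

Lemma cis_turnDz t k : cis_turn (t + k%:~R) = cis_turn t.
Proof. by rewrite cis_turnD cis_turn_int mulr1. Qed.

Lemma sinpi_gt0 t : 0 < t < 1 -> 0 < sin (pi * t).
Proof.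
move=> /andP[t0 t1]; apply: sin_gt0_pi.
by rewrite mulr_gt0 ?pi_gt0//= gtr_pMr// pi_gt0.
Qed.

Lemma cis_turn_eq1 t : cis_turn t = 1 -> exists k, t = k%:~R.
Proof.
move=> t1; exists (Num.floor t); set r := (Num.floor t)%:~R.
have /andP[r0 r1] : r <= t < r + 1.
  by rewrite /r floor_le /= -[1]/(1%:~R) -intrD floorD1_gt.
have c1 : cis_turn (t - r) = 1.
  by rewrite /r -mulrNz cis_turnDz.
have [] := eqVneq t r => // /eqP trN; exfalso.
have : 0 < sin (pi * (t - r)).
  apply: sinpi_gt0; rewrite subr_gt0 ltrBlDl r1 andbT lt_neqAle r0 andbT.
  by apply/eqP => /esym.
have : cos (2 * pi * (t - r)) = 1 by move: c1 => [].
(* By the duplication formula the sine of half the angle vanishes, whereas it is positive on []0,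
   pi[]. *)
rewrite -mulrA mulr_natl cos_mulr2n cos2sin2 => h.
have : sin (pi * (t - r)) ^+ 2 = 0 by lra.
by move=> /eqP; rewrite sqrf_eq0 => /eqP ->; rewrite ltxx.
Qed.

Lemma cis_turn_eqP s t : cis_turn s = cis_turn t <-> eq_turn s t.
Proof.
split=> [st|[k stk]]; last by rewrite -[s](subrK t) stk addrC cis_turnDz.
apply: cis_turn_eq1; rewrite cis_turnD st -cis_turnD subrr.
exact: cis_turn0.
Qed.

Lemma unit_cis_turn u : normc u = 1 -> exists t, u = cis_turn t.
Proof.
move=> u1; have : normc u ^+ 2 = 1 by rewrite u1 expr1n.
rewrite normc_sqr; case: u {u1} => a b /= ab.
have a1 : -1 <= a <= 1 by apply/andP; split; nra.
have pi0 : 2 * pi != 0 :> R by rewrite mulf_neq0// gt_eqF// pi_gt0.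
have [b0|b0] := leP 0 b.
  exists (acos a / (2 * pi)); rewrite /cis_turn mulrC divfK//.
  rewrite acosK ?in_itv//= sin_acos// (_ : 1 - a ^+ 2 = b ^+ 2); last lra.
  by rewrite sqrtr_sqr ger0_norm.
exists (- (acos a / (2 * pi))); rewrite /cis_turn mulrC mulNr divfK// cosN sinN.
rewrite acosK ?in_itv//= sin_acos// (_ : 1 - a ^+ 2 = b ^+ 2); last lra.
by rewrite sqrtr_sqr ltr0_norm// opprK.
Qed.

Lemma dot_cis s t : dot (cis_turn s) (cis_turn t) = cos (2 * pi * (t - s)).
Proof. by rewrite dotE /= mulrBr cosB. Qed.

Lemma eq_turn_frac t : exists2 s, 0 <= s < 1 & eq_turn t s.
Proof.
exists (t - (Num.floor t)%:~R).
  rewrite subr_ge0 floor_le /= ltrBlDl addrC -[1]/(1%:~R) -intrD.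
  by rewrite addrC floorD1_gt.
by exists (Num.floor t); ring.
Qed.

Lemma eq_turn_sym s t : eq_turn s t -> eq_turn t s.
Proof. by move/cis_turn_eqP => h; apply/cis_turn_eqP. Qed.

Lemma eq_turn_inj01 s t : 0 <= s < 1 -> 0 <= t < 1 -> eq_turn s t -> s = t.
Proof.
move=> /andP[s0 s1] /andP[t0 t1] [k st].
have : (-1 < k%:~R :> R) /\ (k%:~R < 1 :> R) by rewrite -st; lra.
rewrite -[-1]/((-1)%:~R) -[1]/(1%:~R) -[-1]/(Negz 0) !ltr_int => -[k1 k2].
have k0 : k = 0 by lia.
by apply/eqP; rewrite -subr_eq0 st k0.
Qed.

Lemma continuous_dot_cis z : continuous (fun t => dot (cis_turn t) z : R).
Proof.
have c2pi : continuous (fun s : R => 2 * pi * s).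
  by move=> s; apply: cvgM; [exact: cvg_cst|exact: cvg_id].
have ccos : continuous (fun s : R => cos (2 * pi * s)).
  move=> s; apply: (@continuous_comp R R R (fun s : R => 2 * pi * s) cos).
    exact: c2pi.
  exact: continuous_cos.
have csin : continuous (fun s : R => sin (2 * pi * s)).
  move=> s; apply: (@continuous_comp R R R (fun s : R => 2 * pi * s) sin).
    exact: c2pi.
  exact: continuous_sin.
move=> t; rewrite (_ : (fun t => _) = (fun t => complex.Re z * cos (2 * pi * t)
   + complex.Im z * sin (2 * pi * t))); last by apply/funext => s; rewrite dotE.
apply: (@cvgD R R^o); apply: cvgM; try exact: cvg_cst.
  exact: ccos.
exact: csin.
Qed.

End Turns.

(** * Faces, sides and supporting directions of plane sets *)

Section Faces.
Context {R : realType}.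
Implicit Types (x y z u v c : R[i]) (A K V : set R[i]) (s t : R).

Lemma face_eq_turn K s t : eq_turn s t -> face K s = face K t.
Proof. by rewrite /face => /cis_turn_eqP ->. Qed.

Lemma convex_face K t : is_convex K -> is_convex (face K t).
Proof.
move=> /is_convexP cK; apply/is_convexP => x y r r01 [Kx xmax] [Ky ymax].
split; first exact: cK.
move=> c Kc; rewrite -!/(dot _ _) dot_comb.
have := xmax _ Kc; have := ymax _ Kc; rewrite -!/(dot _ _) => h1 h2.
move/andP: r01 => [r0 r1].
have := ler_wpM2l r0 h2; have := @ler_wpM2l _ (1 - r) _ _ _ h1.
by rewrite subr_ge0 => /(_ r1); lra.
Qed.

Lemma half_plane_convex u (h : R) : is_convex [set z | dot u z <= h].
Proof.
apply/is_convexP => x y r /andP[r0 r1] /= xh yh; rewrite dot_comb.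
have := ler_wpM2l r0 xh; have := @ler_wpM2l _ (1 - r) _ _ _ yh.
by rewrite subr_ge0 => /(_ r1); lra.
Qed.

Lemma conv_hull_half_plane A u (h : R) : (forall y, A y -> dot u y <= h) ->
  forall y, conv_hull A y -> dot u y <= h.
Proof.
by move=> Ah; apply: (@conv_hull_min _ A [set y | _]) => //;
  exact: half_plane_convex.
Qed.

Lemma face_conv_hull A t : A `&` face (conv_hull A) t = face A t.
Proof.
apply/seteqP; split=> z [Az].
  by move=> [_ zmax]; split => // y Ay; exact: zmax (sub_conv_hull _ _ Ay).
move=> zmax; split => //; split; first exact: sub_conv_hull.
exact: conv_hull_half_plane zmax.
Qed.

Lemma sub_face_conv_hull A t : face A t `<=` face (conv_hull A) t.
Proof. by rewrite -face_conv_hull; exact: subIsetr. Qed.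

(** If the face of [A] is a single point [a], then [a] together with the open half-plane below it is
    a convex set containing [A], hence the hull, whose face is then [a] alone. *)
Lemma has_side_conv_hull A t : face A t !=set0 ->
  has_side (conv_hull A) t <-> has_side A t.
Proof.
move=> [a aA]; split; last first.
  by move=> [x [y [xA yA xy]]]; exists x, y; split=> //; exact: sub_face_conv_hull.
move=> [x [y [xC yC xy]]]; apply: contrapT => nside.
have Aa b : face A t b -> b = a.
  by move=> bA; apply: contrapT => ba; apply: nside; exists b, a.
suff Ca b : face (conv_hull A) t b -> b = a by apply: xy; rewrite (Ca x)// (Ca y).
move=> [Cb bmax].
pose K := [set z | z = a \/ dot (cis_turn t) z < dot (cis_turn t) a].
have : K b.
  apply: (@conv_hull_min _ A K) Cb.
    apply/is_convexP => z z' r /andP[r0 r1]; rewrite /K/= dot_comb.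
    have [->|r00] := eqVneq r 0.
      by rewrite subr0 rmorph0 rmorph1 !mul0r !add0r !mul1r.
    have [->|r11] := eqVneq r 1.
      by rewrite subrr rmorph0 rmorph1 !mul0r !addr0 !mul1r.
    have {r0 r00} r0 : 0 < r by rewrite lt_neqAle eq_sym r00.
    have {r1 r11} r1 : 0 < 1 - r by rewrite subr_gt0 lt_neqAle r11.
    case=> [->|h] [->|h'].
    - by left; rewrite -mulrDl -rmorphD addrC subrK mul1r.
    - by right; nra.
    - by right; nra.
    - by right; nra.
  move=> z Az; have [h|h] := ltP (dot (cis_turn t) z) (dot (cis_turn t) a).
    by right.
  by left; apply: Aa; split=> // y' Ay'; apply: le_trans h; exact: aA.2.
case=> // h.
by have := bmax a (sub_conv_hull _ _ aA.1); rewrite leNgt h.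
Qed.

Lemma compact_face A t : compact A -> compact (face A t).
Proof.
move=> cA.
rewrite (_ : face A t = A `&` \bigcap_(y in A)
    [set z | dot (cis_turn t) y <= dot (cis_turn t) z]); last first.
  by apply/seteqP; split => z [].
apply: compact_closedI => //; apply: closed_bigI => y _.
rewrite (_ : [set z | _] = dot (cis_turn t) @^-1` [set r | dot (cis_turn t) y <= r])//.
apply: preimage_closed; last exact: closed_ge.
by move=> z _; exact: continuous_dot.
Qed.

Lemma face_neq0 A t : compact A -> A !=set0 -> face A t !=set0.
Proof.
move=> cA A0.
have [z /set_mem Az zmax] : exists2 m, m \in A & forall c, c \in A ->
    dot (cis_turn t) c <= dot (cis_turn t) m.
  by apply: compact_EVT_max => //; apply/continuous_subspaceT/continuous_dot.
by exists z; split => // y Ay; exact/zmax/mem_set.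
Qed.

Lemma face_not_interior K t z : face K t z -> ~ interior K z.
Proof.
move=> [Kz zmax] /nbhs_normcP[e e0 eK].
have := zmax (z + (e / 2)%:C * cis_turn t).
rewrite -!/(dot _ _) dotD dotZ dotxx normc_cis expr1n mulr1 gerDl.
have eN : normc (z - (z + (e / 2)%:C * cis_turn t)) < e.
  rewrite opprD addrA subrr add0r normc_opp normcM normc_real normc_cis mulr1.
  by rewrite ger0_norm; lra.
by move=> /(_ (eK _ eN)); lra.
Qed.

(** If [z] lies on no face, some point of [V] exceeds [z] strictly in every direction, so the sum
    [G] of the positive excesses has a positive minimum over a turn. A point [y] outside the hull is
    separated from it in some direction, where each excess is at most [normc (z - y)]; hence [y]
    cannot be too close to [z], and [z] is interior. *)
Lemma supporting_face V z : finite_set V -> V !=set0 ->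
  conv_hull V z -> ~ interior (conv_hull V) z ->
  exists t, face (conv_hull V) t z.
Proof.
move=> finV [v0 Vv0] Cz; apply: contra_notP => /forallNP nface.
have cC := compact_conv_hull _ finV.
have /finite_seqP[l Vl] := finV.
pose G t : R := \sum_(v <- l) Num.max 0 (dot (cis_turn t) v - dot (cis_turn t) z).
have G0 t : 0 < G t.
  have [v vl vz] : exists2 v, v \in l & dot (cis_turn t) z < dot (cis_turn t) v.
    apply: contrapT => /forall2NP H; apply: (nface t); split => //.
    apply: conv_hull_half_plane => v Vv; rewrite /= -!/(dot _ _) leNgt; apply/negP => zv.
    by have [|] := H v; move: Vv; rewrite Vl.
  rewrite /G (perm_big _ (perm_to_rem vl)) big_cons ltr_pwDl//.
    by rewrite lt_max subr_gt0 vz orbT.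
  by apply: sumr_ge0 => v' _; rewrite le_max lexx.
have cG : continuous G.
  move=> t; apply: continuous_big => //; first by move=> p; apply: add_continuous.
  move=> v _ s; apply: (@continuous_max R R (fun=> 0)
    (fun t => dot (cis_turn t) v - dot (cis_turn t) z)); first exact: cvg_cst.
  by apply: (@cvgB R R^o); exact: continuous_dot_cis.
have [t0 _ t0min] : exists2 c, c \in `[(0:R), 1] & forall t, t \in `[(0:R), 1] -> G c <= G t.
  by apply: EVT_min => //; exact: continuous_subspaceT.
apply/nbhs_normcP; exists (G t0 / ((size l)%:R + 1)).
  by rewrite divr_gt0// ltr_wpDl.
move=> y; rewrite ltr_pdivlMr ?ltr_wpDl// => zy; apply: contrapT => nCy.
have [|u u1 usep] := convex_separation _ y (conv_hull_convex V) cC _ nCy.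
  by exists v0; exact: sub_conv_hull.
have [t' ut'] := unit_cis_turn u u1.
have [t t01 /cis_turn_eqP tt'] := eq_turn_frac t'.
have : G t <= (size l)%:R * normc (z - y).
  rewrite /G -sum1_size natr_sum mulr_suml; rewrite big_seq [leRHS]big_seq.
  apply: ler_sum => v vl.
  rewrite mul1r ge_max normc_ge0 /= lerBlDl.
  have Cv : conv_hull V v by apply: sub_conv_hull; rewrite Vl.
  have := usep v Cv; rewrite ut' tt' => /ltW h; apply: le_trans h _.
  rewrite -lerBlDl -dotB (le_trans (dot_le _ _))// normc_cis mul1r normcBC.
  exact: lexx.
have : G t0 <= G t.
  by apply: t0min; rewrite in_itv/=; move: t01 => /andP[-> /ltW ->].
have := normc_ge0 (z - y).
lra.
Qed.

End Faces.

(** * Faces of the attractor *)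

Lemma nearest_int (R : realType) (x : R) : exists j : int, `|j%:~R - x| <= 2^-1.
Proof.
exists (Num.floor (x + 2^-1)).
have /andP[h1 h2] := floor_itv (x + 2^-1).
move: h2; rewrite intrD => h2.
by rewrite ler_norml; apply/andP; split; lra.
Qed.

Lemma nearest_int_unique (R : realType) (x : R) (i j : int) : i != j ->
  `|i%:~R - x| <= 2^-1 -> `|j%:~R - x| <= 2^-1 ->
  exists m : int, x = m%:~R + 2^-1.
Proof.
wlog ij : i j / i < j.
  move=> H; rewrite neq_lt => /orP[] ij hi hj; apply: (H _ _ ij) => //.
    by rewrite lt_eqF.
  by rewrite lt_eqF.
move=> _; rewrite !ler_norml => /andP[h1 h2] /andP[h3 h4]; exists i.
have : (i + 1)%:~R <= j%:~R :> R by rewrite ler_int; lia.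
by rewrite intrD; lra.
Qed.

(** Among the [n] equally spaced digits, those nearest to a direction are extremal, and only those.
    With [r] the residue of [i], the difference of the cosines is
    [2 sin(pi r / n) sin(pi (2 y + r) / n)], where [0 <= 2 y + r <= n]; for [r] non-zero it vanishes
    only at the two ends, which are ties. *)
Lemma cos_nearest (R : realType) (n : nat) (y : R) (i : int) : (2 <= n)%N ->
  `|y| <= 2^-1 ->
  cos (2 * pi * ((y + i%:~R) / n%:R)) <= cos (2 * pi * (y / n%:R)) /\
  (cos (2 * pi * (y / n%:R)) <= cos (2 * pi * ((y + i%:~R) / n%:R)) ->
   exists k : int, `|y + i%:~R - n%:R * k%:~R| <= 2^-1).
Proof.
move=> n2; rewrite ler_norml => /andP[y1 y2].
have n0 : 0 < n%:R :> R by rewrite ltr0n; lia.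
have nN0 : n%:R != 0 :> R by rewrite gt_eqF.
set k := (i %/ n%:Z)%Z; set r := (i %% n%:Z)%Z.
have iE : i = k * n%:Z + r by exact: divz_eq.
have iR : i%:~R = k%:~R * n%:R + r%:~R :> R.
  by rewrite {1}iE intrD intrM.
have r0 : 0 <= r by apply: modz_ge0; lia.
have rn : r < n%:Z by apply: ltz_pmod; lia.
have cE : cos (2 * pi * ((y + i%:~R) / n%:R)) = cos (2 * pi * ((y + r%:~R) / n%:R)).
  rewrite iR (_ : (_ + (_ + _)) / _ = (y + r%:~R) / n%:R + k%:~R); last by field.
  by have [] := cis_turnDz ((y + r%:~R) / n%:R) k.
rewrite {}cE.
have [r00|rN0] := eqVneq r 0.
  rewrite r00 addr0; split => // _; exists k.
  rewrite iR r00 addr0 (mulrC n%:R) addrK ler_norml.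
  by rewrite y1 y2.
have r1 : 1 <= r%:~R :> R by rewrite -[1]/(1%:~R) ler_int; lia.
have rn1 : r%:~R <= n%:R - 1 :> R.
  by rewrite lerBrDr -[1]/(1%:~R) -[n%:R]/(n%:Z%:~R) -intrD ler_int; lia.
have cB : cos (2 * pi * (y / n%:R)) - cos (2 * pi * ((y + r%:~R) / n%:R)) =
    2 * sin (pi * (r%:~R / n%:R)) * sin (pi * ((2 * y + r%:~R) / n%:R)).
  set a := pi * (r%:~R / n%:R); set c := pi * ((2 * y + r%:~R) / n%:R).
  rewrite (_ : 2 * pi * (y / n%:R) = c - a); last by rewrite /a /c; field.
  rewrite (_ : 2 * pi * ((y + _) / n%:R) = c + a); last by rewrite /a /c; field.
  by rewrite cosB cosD; ring.
have s1 : 0 < sin (pi * (r%:~R / n%:R)) :> R.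
  apply: sinpi_gt0; rewrite divr_gt0 ?ltr_pdivrMr//=; lra.
have [e0|eN0] := eqVneq (2 * y + r%:~R) 0.
  split.
    by rewrite -subr_ge0 cB e0 mul0r mulr0 sin0 mulr0.
  move=> _; exists k; rewrite iR ler_norml; apply/andP; split; lra.
have [en|eNn] := eqVneq (2 * y + r%:~R) n%:R.
  split.
    by rewrite -subr_ge0 cB en divff// mulr1 sinpi mulr0.
  by move=> _; exists (k + 1); rewrite iR intrD ler_norml; apply/andP; split; lra.
have s2 : 0 < sin (pi * ((2 * y + r%:~R) / n%:R)).
  apply: sinpi_gt0; rewrite divr_gt0 ?ltr_pdivrMr//= ?mul1r.
    by rewrite lt_neqAle eNn; lra.
  by rewrite lt_neqAle eq_sym eN0; lra.
have : 0 < cos (2 * pi * (y / n%:R)) - cos (2 * pi * ((y + r%:~R) / n%:R)).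
  by rewrite cB !mulr_gt0.
rewrite subr_gt0 => h; split; first exact: ltW.
by rewrite leNgt h.
Qed.

Lemma nearest_half (R : realType) (m j : int) :
  `|j%:~R - (m%:~R + 2^-1)| <= (2^-1 : R) <-> j = m \/ j = m + 1.
Proof.
rewrite ler_norml; split=> [/andP[h1 h2]|[->|->]].
- have : m%:~R <= j%:~R :> R by lra.
  have : j%:~R <= (m + 1)%:~R :> R by rewrite intrD; lra.
  by rewrite !ler_int; lia.
- by apply/andP; split; lra.
- by rewrite intrD; apply/andP; split; lra.
Qed.

Lemma modz_lt (N : nat) (k : int) : (0 < N)%N -> (`|(k %% N%:Z)%Z| < N)%N.
Proof.
move=> N0; have Nz0 : N%:Z != 0 by rewrite eqz_nat -lt0n.
by rewrite -ltz_nat gez0_abs ?modz_ge0// ltz_pmod.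
Qed.

Section Digits.
Context {R : realType} (n : nat) (w lam : R[i]) (A : set R[i]) (phi omega : R).
Hypotheses (n2 : (2 <= n)%N) (w0 : w != 0) (lam01 : 0 < normc lam < 1).
Hypothesis attrA : is_attractor n (ifs_map n w lam) A.
Hypotheses (argl : turn_arg lam phi) (argw : turn_arg w omega).

(** Indexed by all integers, so that the integer nearest to a position serves as a digit without
    reduction modulo [n]. *)
Definition digit (j : int) : R[i] := cis_turn (j%:~R / n%:R) * w.

(* The face of [A] in the direction [omega + x / n]: in this scale the digits
   point at the integers modulo [n], and dividing by [lam] shifts [x]
   by [- n phi]. *)
Definition Aface (x : R) : set R[i] := face A (omega + x / n%:R).

Let n_gt0 : (0 < n)%N. Proof. exact: ltnW. Qed.
Let nz0 : n%:Z != 0. Proof. by rewrite eqz_nat -lt0n. Qed.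
Let n0 : 0 < n%:R :> R. Proof. by rewrite ltr0n. Qed.
Let nN0 : n%:R != 0 :> R. Proof. by rewrite gt_eqF. Qed.

Lemma xi_digit (j : nat) : xi R n ^+ j * w = digit j%:Z.
Proof. by rewrite /xi cis_turnX. Qed.

Lemma digit_period (j k : int) : digit (j + n%:Z * k) = digit j.
Proof.
rewrite /digit -[in RHS](cis_turnDz _ k); congr (cis_turn _ * _).
by rewrite intrD intrM -[n%:Z%:~R]/(n%:R); field.
Qed.

Lemma digit_modn (j : int) : digit j = digit (`|(j %% n%:Z)%Z|%N)%:Z.
Proof.
rewrite gez0_abs ?modz_ge0//.
by rewrite {1}(divz_eq j n%:Z) addrC mulrC digit_period.
Qed.

Lemma digitS (j : int) : digit (j + 1) = cis_turn n%:R^-1 * digit j.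
Proof.
by rewrite /digit mulrA -cis_turnD intrD mulrDl mul1r addrC.
Qed.

Lemma digitS_neq (j : int) : digit (j + 1) != digit j.
Proof.
rewrite /digit (inj_eq (mulIf w0)) intrD mulrDl mul1r.
apply/eqP => /cis_turn_eqP [k]; rewrite addrC addKr => nk.
have : (0 < n%:R^-1 :> R) && (n%:R^-1 < 1 :> R).
  by rewrite invr_gt0 n0 invf_lt1// ltr1n.
by rewrite nk ltr0z ltrz1; clear; lia.
Qed.

Lemma attractorP z :
  A z <-> exists j a, A a /\ z = lam * a + digit j.
Proof.
have [_ _ AE] := attrA; split.
  rewrite {1}AE => -[j _ [a Aa <-]]; exists j%:Z, a; split => //.
  by rewrite -xi_digit.
move=> [j [a [Aa ->]]]; rewrite AE; exists (`|(j %% n%:Z)%Z|%N) => /=.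
  exact: modz_lt.
by exists a => //; rewrite /ifs_map xi_digit -digit_modn.
Qed.

Lemma compactA : compact A. Proof. by case: attrA. Qed.

Lemma Aface_compact x : compact (Aface x).
Proof. exact/compact_face/compactA. Qed.

Lemma Aface_neq0 x : Aface x !=set0.
Proof. by apply: face_neq0; [exact: compactA|case: attrA]. Qed.

Lemma sub_Aface x : Aface x `<=` A. Proof. by move=> z []. Qed.

Lemma Aface_period x (k : int) : Aface (x + n%:R * k%:~R) = Aface x.
Proof. by apply: face_eq_turn; exists k; field. Qed.

Lemma lamE : lam = (normc lam)%:C * cis_turn phi.
Proof. by rewrite -normE. Qed.

Lemma dot_lam t z :
  dot (cis_turn t) (lam * z) = normc lam * dot (cis_turn (t - phi)) z.
Proof.
rewrite {1}lamE -mulrA dotZ dot_mul -cis_turnN -cis_turnD.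
by rewrite (addrC t).
Qed.

Lemma dot_digit x j : dot (cis_turn (omega + x / n%:R)) (digit j) =
  normc w * cos (2 * pi * ((j%:~R - x) / n%:R)).
Proof.
have wE : w = (normc w)%:C * cis_turn omega by rewrite -normE.
rewrite /digit {1}wE mulrCA dotZ -cis_turnD dot_cis.
by congr (_ * cos (_ * _)); field.
Qed.

Lemma dot_shift x z : dot (cis_turn (omega + x / n%:R)) (lam * z) =
  normc lam * dot (cis_turn (omega + (x - n%:R * phi) / n%:R)) z.
Proof. by rewrite dot_lam; congr (_ * dot (cis_turn _) _); field. Qed.

Lemma dot_digit_le x i j : `|i%:~R - x| <= 2^-1 ->
  dot (cis_turn (omega + x / n%:R)) (digit j)
    <= dot (cis_turn (omega + x / n%:R)) (digit i) /\
  (dot (cis_turn (omega + x / n%:R)) (digit i)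
    <= dot (cis_turn (omega + x / n%:R)) (digit j) ->
   exists k : int, `|(j - n%:Z * k)%:~R - x| <= 2^-1).
Proof.
move=> ix; rewrite !dot_digit !ler_pM2l ?normc_gt0//.
have [h1 h2] := cos_nearest _ n _ (j - i) n2 ix.
have jE : i%:~R - x + (j - i)%:~R = j%:~R - x :> R by rewrite intrB; ring.
rewrite jE in h1 h2; split=> // /h2[k hk]; exists k.
by rewrite intrB intrM addrAC.
Qed.

(** The product of a direction with [lam * a + digit j] is a sum of two terms maximized
    independently: the first over [A] in the direction turned by [- phi], the second by the nearest
    digits. *)
Lemma AfaceP x z : Aface x z <-> exists j a,
  [/\ `|j%:~R - x| <= 2^-1, Aface (x - n%:R * phi) a & z = lam * a + digit j].
Proof.
have /andP[l0 _] := lam01; split.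
  move=> [/attractorP[i [a [Aa zE]]] zmax].
  have [j jx] := nearest_int _ x.
  have Aa' : Aface (x - n%:R * phi) a.
    split => // y Ay; rewrite -!/(dot _ _).
    have /zmax : A (lam * y + digit i) by apply/attractorP; exists i, y.
    by rewrite -!/(dot _ _) zE !dotD lerD2r !dot_shift ler_pM2l.
  (* The digit [i] does as well as the nearest one, so some integer congruent to [i] modulo [n] is
     also within 1/2 of [x]. *)
  have [_] := dot_digit_le _ _ i jx; case.
    have /zmax : A (lam * a + digit j) by apply/attractorP; exists j, a.
    by rewrite -!/(dot _ _) zE !dotD lerD2l.
  move=> k kx; exists (i - n%:Z * k), a; split => //.
  by rewrite -mulrN digit_period.
move=> [j [a [jx [Aa amax] ->]]]; split; first by apply/attractorP; exists j, a.
move=> y /attractorP[i [a' [Aa' ->]]]; rewrite -!/(dot _ _) !dotD.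
apply: lerD; last exact: (dot_digit_le _ _ _ jx).1.
by rewrite !dot_shift ler_pM2l//; exact: amax.
Qed.

(* The directions in which some iterate of the shift by [- n phi] is at the
   same distance of two consecutive digits. *)
Definition tie (x : R) : Prop :=
  exists (k : nat) (m : int), x = k%:R * (n%:R * phi) + m%:~R + 2^-1.

Lemma Aface_no_half x : (forall m : int, x <> m%:~R + 2^-1) ->
  exists j, forall z, Aface x z <->
    exists2 a, Aface (x - n%:R * phi) a & z = lam * a + digit j.
Proof.
move=> nhalf; have [j jx] := nearest_int _ x; exists j => z; split.
  move=> /AfaceP[i [a [ix Aa ->]]]; exists a => //.
  have [-> //|ij] := eqVneq i j.
  by have [m /nhalf] := nearest_int_unique _ x _ _ ij ix jx.
by move=> [a Aa ->]; apply/AfaceP; exists j, a.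
Qed.

(** At a half-integer, two distinct digits applied to one point give two points of the face; at
    later iterates an injective map carries two points along. *)
Lemma tie_has_side x : tie x -> has_side A (omega + x / n%:R).
Proof.
have /andP[l0 _] := lam01; have lamN0 : lam != 0 by rewrite -normc_gt0.
move=> [k [m ->]]; elim: k => [|k IH] in m *.
  rewrite mul0r add0r; set x0 := m%:~R + 2^-1.
  have [a Aa] := Aface_neq0 (x0 - n%:R * phi).
  exists (lam * a + digit m), (lam * a + digit (m + 1)); split.
  - apply/AfaceP; exists m, a; split => //.
    by rewrite /x0 ler_norml; apply/andP; split; lra.
  - apply/AfaceP; exists (m + 1), a; split => //.
    by rewrite /x0 intrD ler_norml; apply/andP; split; lra.
  - by move=> /addrI /eqP; rewrite eq_sym (negbTE (digitS_neq _)).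
set y := (X in omega + X / _); have [a [b [Aa Ab ab]]] := IH m.
have [j jx] := nearest_int _ y.
have xE : y - n%:R * phi = k%:R * (n%:R * phi) + m%:~R + 2^-1.
  by rewrite /y -natr1; ring.
exists (lam * a + digit j), (lam * b + digit j); split.
- by apply/AfaceP; exists j, a; split => //; rewrite xE.
- by apply/AfaceP; exists j, b; split => //; rewrite xE.
- by move=> /addIr /(mulfI lamN0).
Qed.

Lemma half_tie (m : int) : tie (m%:~R + 2^-1).
Proof. by exists 0%N, m; rewrite mul0r add0r. Qed.

Lemma tie_shift x : tie (x - n%:R * phi) -> tie x.
Proof.
move=> [k [m xE]]; exists k.+1, m.
by rewrite -[LHS](subrK (n%:R * phi)) xE -natr1; ring.
Qed.

(** With no tie along the shifts the digit is forced each time, so two points of the face can be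
    pulled back forever, their distance being divided by [normc lam]; this contradicts boundedness
    unless they are equal. *)
Lemma Aface_inj x a b : ~ tie x -> Aface x a -> Aface x b -> a = b.
Proof.
have /andP[l0 l1] := lam01.
have [M AM] := compact_normc_bounded _ compactA.
move=> xt Aa Ab; apply/eqP; rewrite -subr_eq0.
have -> : (a - b == 0) = (normc (a - b) == 0).
  by apply/eqP/eqP => [->|/eq0_normc//]; rewrite normc0.
rewrite eq_le normc_ge0 andbT.
apply: (@expr_squeeze _ (normc lam) (M + M)); first by rewrite l1 ltW.
move=> k; elim: k => [|k IH] in x xt a Aa b Ab *.
  rewrite expr0 mul1r (le_trans (ler_normcD _ _))// normc_opp.
  by rewrite lerD// AM//; [case: Aa|case: Ab].
have [|j jE] := Aface_no_half x.
  by move=> m xm; apply: xt; rewrite xm; exact: half_tie.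
move/jE : Aa => [a' Aa' ->]; move/jE : Ab => [b' Ab' ->].
rewrite opprD addrACA subrr addr0 -mulrBr normcM exprS -mulrA ler_pM2l//.
by apply: IH Aa' _ Ab' => /tie_shift.
Qed.

Lemma has_side_tie t :
  has_side (conv_hull A) t <-> tie (n%:R * (t - omega)).
Proof.
set x := n%:R * (t - omega).
have tE : t = omega + x / n%:R by rewrite /x; field.
rewrite tE has_side_conv_hull; last exact: Aface_neq0.
split; last exact: tie_has_side.
move=> [a [b [Aa Ab ab]]]; apply: contrapT => xt.
by apply: ab; exact: Aface_inj xt Aa Ab.
Qed.

Lemma normc_digitS_sub j :
  normc (digit (j + 1) - digit j) = normc (cis_turn n%:R^-1 - 1) * normc w.
Proof.
rewrite digitS -{2}[digit j]mul1r -mulrBl normcM; congr (_ * _).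
by rewrite normcM normc_cis mul1r.
Qed.

Lemma normc_digitS_sub_gt0 : 0 < normc (cis_turn n%:R^-1 - 1) * normc w.
Proof. by rewrite -(normc_digitS_sub 0) normc_gt0 subr_eq0 digitS_neq. Qed.

Lemma irrational_shift (k : nat) (m : int) : irrational phi ->
  (k.+1)%:R * phi * n%:R <> m%:~R.
Proof.
move=> irr kE; apply: irr; apply/rationalP; exists m, (k.+1 * n)%N.
by rewrite -kE natrM; field; rewrite nN0 nat1r pnatr_eq0.
Qed.

(** The direction shifted once from the bisector [2^-1] is not a tie, so its face is one point and
    the face at the bisector is a pair, which misses its midpoint. *)
Lemma not_convex_irrational : irrational phi -> ~ is_convex A.
Proof.
move=> irr /(convex_face _ (omega + 2^-1 / n%:R)) /is_convexP cF.
have xt : ~ tie (2^-1 - n%:R * phi).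
  move=> [k [m xE]]; apply: (irrational_shift k (- m) irr).
  by rewrite rmorphN /= -natr1; lra.
have [a0 Aa0] := Aface_neq0 (2^-1 - n%:R * phi).
have AE z : Aface 2^-1 z <-> z = lam * a0 + digit 0 \/ z = lam * a0 + digit (0 + 1).
  split.
    move=> /AfaceP[j [a [jx Aa ->]]]; rewrite (Aface_inj _ _ _ xt Aa Aa0).
    have := (nearest_half R 0 j).1; rewrite add0r => /(_ jx)[->|->].
      by left.
    by right.
  move=> zE; apply/AfaceP.
  have h (j : int) : j = 0 \/ j = 0 + 1 -> `|j%:~R - 2^-1| <= 2^-1 :> R.
    by move=> /(nearest_half R 0 j).2; rewrite [0%:~R + _]add0r.
  case: zE => ->; [exists 0, a0|exists (0 + 1), a0]; split => //; apply: h.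
    by left.
  by right.
have half01 : 0 <= (2^-1 : R) <= 1 by apply/andP; split; lra.
have := cF _ _ (2^-1) half01 ((AE _).2 (or_introl erefl)) ((AE _).2 (or_intror erefl)).
move=> /AE h; have /eqP := digitS_neq 0; apply.
have two0 : (2 : R[i]) != 0 by rewrite pnatr_eq0.
have e : (1 - 2^-1 : R) = 2^-1 by lra.
rewrite e fmorphV rmorph_nat in h.
(* If the midpoint is one of the two points, digits 0 and 1 coincide. *)
case: h => h; apply/eqP; rewrite -subr_eq0.
  rewrite (_ : _ - _ = 2 * ((2^-1 * (lam * a0 + digit 0) +
    2^-1 * (lam * a0 + digit (0 + 1))) - (lam * a0 + digit 0))); last by field.
  by rewrite h subrr mulr0.
rewrite (_ : _ - _ = - 2 * ((2^-1 * (lam * a0 + digit 0) +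
  2^-1 * (lam * a0 + digit (0 + 1))) - (lam * a0 + digit (0 + 1)))); last by field.
by rewrite h subrr mulr0.
Qed.

(** The shifts of the bisector [2^-1] all carry sides, and two of them agreeing modulo 1 would make
    [phi] rational. *)
Lemma infinite_sides_irrational : irrational phi ->
  ~ finite_set (side_angles (conv_hull A)).
Proof.
move=> irr finS.
have /choice[f Hf] k : exists s, (0 <= s < 1) /\
    eq_turn (omega + (k%:R * (n%:R * phi) + 2^-1) / n%:R) s.
  by have [s s01 es] := eq_turn_frac (omega + (k%:R * (n%:R * phi) + 2^-1) / n%:R);
    exists s.
have fS k : side_angles (conv_hull A) (f k).
  have [f01 fe] := Hf k; split => //.
  have [x [y [xF yF xy]]] : has_side (conv_hull A)
      (omega + (k%:R * (n%:R * phi) + 2^-1) / n%:R).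
    apply/has_side_tie; exists k, 0; rewrite addr0; field.
    exact: nN0.
  by exists x, y; rewrite -(face_eq_turn _ _ _ fe).
have finj : injective f.
  have lt_neq i j : (i < j)%N -> f i <> f j.
    move=> ij fij; have [_ /cis_turn_eqP ei] := Hf i; have [_ /cis_turn_eqP ej] := Hf j.
    have /cis_turn_eqP[m em] := etrans (etrans ej (esym (congr1 _ fij))) (esym ei).
    apply: (irrational_shift (j - i.+1) (n%:Z * m) irr).
    rewrite intrM -em -[n%:Z%:~R]/(n%:R) subnSK// natrB; last exact: ltnW.
    field; exact: nN0.
  move=> i j fij; case: (ltngtP i j) => // ij.
    by have := lt_neq _ _ ij fij.
  by have := lt_neq _ _ ij (esym fij).
have := @finite_preimage _ _ _ f (in2W finj) finS.
rewrite (_ : f @^-1` _ = [set: nat]); first exact: infinite_nat.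
by apply/seteqP; split => // k _; exact: fS.
Qed.

(** * Rational angles *)

Section Rational.
(** [s / b] is the reduced fraction of [n * phi], so [b] is the period of the shift modulo 1. *)
Variables (b : nat) (s : int).
Hypotheses (b0 : (0 < b)%N) (phis : n%:R * phi = s%:~R / b%:R).
Hypothesis cop : coprimez s b%:Z.

Let bR0 : 0 < b%:R :> R. Proof. by rewrite ltr0n. Qed.
Let bN0 : b%:R != 0 :> R. Proof. by rewrite gt_eqF. Qed.

(* The [k]-th side of the hull of [A] is at the angle [omega + pos k / n]. *)
Definition pos (k : int) : R := 2^-1 + k%:~R / b%:R.

Lemma pos_shift k : pos k - n%:R * phi = pos (k - s).
Proof. by rewrite phis /pos intrB; field. Qed.

Lemma pos_shiftn k (i : nat) : pos k - i%:R * (n%:R * phi) = pos (k - i%:Z * s).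
Proof. by rewrite phis /pos intrB intrM; field. Qed.

Lemma pos_period k (m : int) :
  pos (k + (n * b)%:Z * m) = pos k + n%:R * m%:~R.
Proof.
rewrite /pos intrD intrM -[(n * b)%:Z%:~R]/((n * b)%:R) natrM; field.
exact: bN0.
Qed.

Lemma Aface_pos_period k (m : int) :
  Aface (pos (k + (n * b)%:Z * m)) = Aface (pos k).
Proof. by rewrite pos_period Aface_period. Qed.

(** By Bezout [s] is invertible modulo [b], so its multiples reach every residue and the ties fill
    the whole grid of step [1 / b]. *)
Lemma tie_pos x : tie x <-> exists k, x = pos k.
Proof.
split=> [[i [m ->]]|[k ->]].
  exists (i%:Z * s + m * b%:Z); rewrite phis /pos intrD !intrM.
  by rewrite -[b%:Z%:~R]/(b%:R) -[i%:Z%:~R]/(i%:R); field.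
have /coprimezP[[u v]/= uv] := cop.
have bz0 : b%:Z != 0 by rewrite eqz_nat -lt0n.
(* Reduction modulo [b] makes the number of shifts non-negative, as [tie] demands. *)
set i := (k * u %% b%:Z)%Z; have i0 : 0 <= i by exact: modz_ge0.
set c := (k * u %/ b%:Z)%Z.
have kE : k = i * s + (k * v + c * s) * b%:Z.
  have kuE : k * u = c * b%:Z + i by exact: divz_eq.
  transitivity (k * (u * s + v * b%:Z)); first by rewrite uv mulr1.
  by rewrite mulrDr mulrA kuE; ring.
exists `|i|%N, (k * v + c * s).
rewrite phis {1}/pos {1}kE intrD [in LHS]intrM [(_ * b%:Z)%:~R]intrM.
rewrite -[`|i|%N%:R]/(`|i|%N%:Z%:~R) gez0_abs// -[b%:Z%:~R]/(b%:R).
by field.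
Qed.

(* [x] and [pos k] stay on the same side of the half-integers along the
   shifts, so that the maximizing digits for [x] are maximizing for [pos k]. *)
Lemma Aface_between x k : pos k <= x <= pos (k + 1) ->
  (forall m, x <> pos m) -> Aface x `<=` Aface (pos k).
Proof.
move=> xk nx.
have [M AM] := compact_normc_bounded _ compactA.
have /andP[_ l1] := lam01.
suff H : forall i : nat, Aface (x - i%:R * (n%:R * phi)) `<=`
    Aface (pos k - i%:R * (n%:R * phi)).
  by have := H 0%N; rewrite mul0r !subr0.
apply: (@contraction_subset R nat _ _ (normc lam) (M + M)).
- by rewrite normc_ge0.
- move=> i y z /sub_Aface/AM yM /sub_Aface/AM zM.
  by rewrite (le_trans (ler_normcD _ _))// normc_opp lerD.
- move=> i; split; first exact: Aface_neq0.
  exact: (plane_compact_closed _ (Aface_compact _)).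
move=> i z /AfaceP[j [a [jx Aa ->]]].
exists i.+1, a, lam, (digit j); split => //.
  by rewrite (_ : _ - _ = x - i%:R * (n%:R * phi) - n%:R * phi)// -natr1; ring.
move=> y Ay; apply/AfaceP; exists j, y; split => //; last first.
  rewrite (_ : _ - _ = pos k - i.+1%:R * (n%:R * phi))//.
  by rewrite -natr1; ring.
have xiE : x - i%:R * (n%:R * phi) = x - i%:R * (s%:~R / b%:R) by rewrite phis.
move: jx; rewrite pos_shiftn phis.
have [k' k'E] : exists k', k' = k - i%:Z * s by exists (k - i%:Z * s).
have h1 : pos k' <= x - i%:R * (s%:~R / b%:R) <= pos (k' + 1).
  have -> : k' + 1 = (k + 1) - i%:Z * s by rewrite k'E addrAC.
  by rewrite k'E -!pos_shiftn phis !lerD2r.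
have nx' m : x - i%:R * (s%:~R / b%:R) <> pos m.
  move=> xm; apply: (nx (m + i%:Z * s)).
  rewrite -[LHS](subrK (i%:R * (s%:~R / b%:R))) xm /pos intrD intrM.
  by rewrite -[i%:Z%:~R]/(i%:R); field.
set x' := x - _ in h1 nx' *.
rewrite ler_norml => /andP[h2 h3].
(* Half-integers are grid points, so none lies strictly between [pos k'] and [pos (k' + 1)], where
   [x'] is. Hence [pos k'] stays in the interval of radius 1/2 around [j]. *)
have posE m : pos (b%:Z * m) = 2^-1 + m%:~R.
  by rewrite /pos intrM -[b%:Z%:~R]/(b%:R); field.
have ltpos m m' : (pos m < pos m') = (m < m').
  by rewrite /pos ltrD2l ltr_pM2r ?invr_gt0// ltr_int.
have lepos m m' : (pos m <= pos m') = (m <= m').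
  by rewrite /pos lerD2l ler_pM2r ?invr_gt0// ler_int.
have k1 : b%:Z * (j - 1) <= k'.
  suff : pos (b%:Z * (j - 1)) < pos (k' + 1) by rewrite ltpos ltzD1.
  rewrite posE intrB; apply: (@le_lt_trans _ _ x'); first lra.
  rewrite lt_neqAle (andP h1).2 andbT; exact/eqP.
have k2 : k' + 1 <= b%:Z * j.
  suff : pos k' < pos (b%:Z * j) by rewrite ltpos lezD1.
  rewrite posE; apply: (@lt_le_trans _ _ x'); last lra.
  rewrite lt_neqAle (andP h1).1 andbT; apply/eqP => /esym; exact: nx'.
have : pos (b%:Z * (j - 1)) <= pos k' <= pos (b%:Z * j).
  by rewrite !lepos k1 (le_trans _ k2)// lerDl.
rewrite -k'E !posE intrB => /andP[h4 h5].
by rewrite ler_norml; apply/andP; split; lra.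
Qed.

Lemma Aface_sub_pos x : exists k, Aface x `<=` Aface (pos k).
Proof.
have [[k xk]|nx] := pselect (exists k, x = pos k); first by exists k; rewrite xk.
exists (Num.floor ((x - 2^-1) * b%:R)); set k := Num.floor _.
apply: Aface_between; last by move=> m xm; apply: nx; exists m.
have := floor_itv ((x - 2^-1) * b%:R); rewrite -/k -ler_pdivrMr//.
rewrite -ltr_pdivlMr// /pos => /andP[h1 h2].
by apply/andP; split; [|apply/ltW]; lra.
Qed.

Lemma half_pos (k m : int) : pos k = m%:~R + 2^-1 -> k = m * b%:Z.
Proof.
rewrite /pos addrC => /addIr h; apply/eqP; rewrite -(eqr_int R) intrM.
by rewrite -h divfK.
Qed.

(** The sums of [lam ^+ i * digit (j_i)] over [i < k], in Horner form. *)
Fixpoint digit_sums (k : nat) : set R[i] :=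
  if k is k'.+1 then
    [set z | exists2 y, digit_sums k' y & exists j, z = lam * y + digit j]
  else [set 0].

Lemma finite_digit_sums k : finite_set (digit_sums k).
Proof.
elim: k => [|k IH] /=; first exact: finite_set1.
apply: (@sub_finite_set _ _
  [set lam * y + digit (j : nat)%:Z | y in digit_sums k & j in `I_n]).
  move=> z [y Sy [j ->]]; exists y => //; exists `|(j %% n%:Z)%Z|%N.
    exact: modz_lt.
  by rewrite -digit_modn.
by apply: finite_image2 => //; exact: finite_II.
Qed.

Lemma rot_digit_sums k (i : int) y :
  digit_sums k y -> digit_sums k (cis_turn (i%:~R / n%:R) * y).
Proof.
elim: k y => [|k IH] y /=; first by move=> ->; rewrite mulr0.
move=> [y' Sy' [j ->]]; exists (cis_turn (i%:~R / n%:R) * y'); first exact: IH.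
exists (i + j); rewrite mulrDr mulrCA; congr (_ + _).
by rewrite /digit mulrA -cis_turnD -mulrDl intrD.
Qed.

Lemma digit_sums_neq0 k : digit_sums k !=set0.
Proof.
elim: k => [|k [y Sy]]; first by exists 0.
by exists (lam * y + digit 0), y => //; exists 0.
Qed.

Lemma attractor_sumsP k z :
  A z <-> exists a y, [/\ A a, digit_sums k y & z = lam ^+ k * a + y].
Proof.
elim: k z => [|k IH] z.
  split=> [Az|[a [y [Aa -> ->]]]]; last by rewrite mul1r addr0.
  by exists z, 0; rewrite mul1r addr0.
split.
  move=> /attractorP[j [a' [/IH[a [y [Aa Sy ->]]] ->]]].
  exists a, (lam * y + digit j); split => //; first by exists y => //; exists j.
  by rewrite exprS; ring.
move=> [a [_ [Aa [y Sy [j ->]] ->]]]; apply/attractorP.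
exists j, (lam ^+ k * a + y); split; last by rewrite exprS; ring.
by apply/IH; exists a, y.
Qed.

Let r := normc lam ^+ b.

Lemma ratio01 : 0 < r < 1.
Proof.
have /andP[l0 l1] := lam01.
by rewrite exprn_gt0//= exprn_ilt1 ?normc_ge0// -lt0n.
Qed.

Lemma lamXb : lam ^+ b = r%:C * cis_turn (s%:~R / n%:R).
Proof.
rewrite {1}lamE exprMn cis_turnX /r rmorphXn; congr (_ * cis_turn _).
apply: (mulfI nN0); rewrite mulrCA phis; field.
by rewrite nN0 bN0.
Qed.

(* [lam ^+ b] is, up to a rotation preserving the digits, the homothety of
   ratio [r], and [r / (1 - r) + 1 = 1 / (1 - r)]. *)
Definition vertices : set R[i] :=
  [set (1 - r)^-1%:C * y | y in digit_sums b].

Lemma finite_vertices : finite_set vertices.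
Proof. by apply: finite_image; exact: finite_digit_sums. Qed.

(** Shows each vertex as the image of a rotated vertex under the map [z -> lam ^+ b * z + y], which
    is a composite of [b] maps of the IFS when [y] is a digit sum. *)
Lemma lamXb_vertex y :
  lam ^+ b * (cis_turn ((- s)%:~R / n%:R) * ((1 - r)^-1%:C * y)) + y =
  (1 - r)^-1%:C * y.
Proof.
have /andP[r0 r1] := ratio01.
have rN : 1 - r != 0 by rewrite subr_eq0 gt_eqF.
rewrite lamXb mulrA -(mulrA r%:C) -cis_turnD rmorphN mulNr subrr cis_turn0 mulr1.
by case: y => y1 y2; apply: complex_ext; rewrite /=; field.
Qed.

(** The hull is invariant under the rotation contained in [lam ^+ b]; up to it, [lam ^+ b * z + y]
    is the convex combination of [z] and the vertex [y / (1 - r)] with weights [r] and [1 - r]. So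
    the maps of depth [b] preserve the hull. *)
Lemma sub_conv_vertices : A `<=` conv_hull vertices.
Proof.
have /andP[r0 r1] := ratio01.
have rN : 1 - r != 0 by rewrite subr_eq0 gt_eqF.
have cV := compact_conv_hull _ finite_vertices.
have [M AM] := compact_normc_bounded _ compactA.
have [M' VM] := compact_normc_bounded _ cV.
have V0 : conv_hull vertices !=set0.
  have [y Sy] := digit_sums_neq0 b.
  by exists ((1 - r)^-1%:C * y); apply: sub_conv_hull; exists y.
apply: (@contraction_subset R unit (fun=> A) (fun=> conv_hull vertices)
  r (M + M') _ _ _ _ tt) => //.
- by rewrite r1 ltW.
- move=> _ x y /AM xM /VM yM.
  by rewrite (le_trans (ler_normcD _ _))// normc_opp lerD.
- by move=> _; split => //; exact: plane_compact_closed.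
move=> _ x /(attractor_sumsP b)[a [y [Aa Sy ->]]].
exists tt, a, (lam ^+ b), y; split => //; first by rewrite normcX.
have rotV z : conv_hull vertices z ->
    conv_hull vertices (cis_turn (s%:~R / n%:R) * z).
  move=> Vz; have := Vz; rewrite -[_ * z]addr0; move: z {Vz}.
  apply: conv_hull_min.
    exact: (convex_affine_preimage _ _ _ (conv_hull_convex vertices)).
  move=> _ [z Sz <-] /=; rewrite addr0 mulrCA; apply: sub_conv_hull.
  by exists (cis_turn (s%:~R / n%:R) * z) => //; exact: rot_digit_sums.
move=> z /rotV Vz; rewrite lamXb -mulrA.
have /is_convexP cC := conv_hull_convex vertices.
rewrite -[y](_ : (1 - r)%:C * ((1 - r)^-1%:C * y) = y).
  apply: cC => //; first by rewrite !ltW.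
  by apply: sub_conv_hull; exists y.
by rewrite mulrA -rmorphM divff// mul1r.
Qed.

Lemma vertices_sub : vertices `<=` A.
Proof.
have /andP[r0 r1] := ratio01.
have [M' VM] := compact_normc_bounded _ (compact_conv_hull _ finite_vertices).
have [M AM] := compact_normc_bounded _ compactA.
apply: (@contraction_subset R unit (fun=> vertices) (fun=> A)
  r (M' + M) _ _ _ _ tt) => //.
- by rewrite r1 ltW.
- move=> _ x y /sub_conv_hull/VM xM /AM yM.
  by rewrite (le_trans (ler_normcD _ _))// normc_opp lerD.
- by move=> _; split; [case: attrA|exact: (plane_compact_closed _ compactA)].
move=> _ _ [y Sy <-].
exists tt, (cis_turn ((- s)%:~R / n%:R) * ((1 - r)^-1%:C * y)), (lam ^+ b), y.
split.
- rewrite mulrCA; eexists; last by [].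
  exact: rot_digit_sums.
- by rewrite lamXb_vertex.
- by rewrite normcX.
- by move=> a Aa; apply/(attractor_sumsP b); exists a, y.
Qed.

Lemma conv_hull_vertices : conv_hull A = conv_hull vertices.
Proof.
apply/seteqP; split; apply: conv_hull_min; try exact: conv_hull_convex.
  exact: sub_conv_vertices.
by move=> z /vertices_sub; exact: sub_conv_hull.
Qed.

(** The hull has finitely many generators, so a boundary point lies on a face in some direction, and
    every face of [A] is contained in one at a grid direction. *)
Lemma extreme_pointsP z :
  extreme_points A z <-> exists k, Aface (pos k) z.
Proof.
have fcE := face_conv_hull A.
split=> [[Az [_ nint]]|[k Fz]]; last first.
  split; first exact: sub_Aface Fz.
  split; first exact: subset_closure (sub_conv_hull _ _ (sub_Aface _ _ Fz)).
  by apply: (face_not_interior _ (omega + pos k / n%:R)); exact: sub_face_conv_hull.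
have [|||t] := supporting_face _ z finite_vertices.
- have [y Sy] := digit_sums_neq0 b.
  by exists ((1 - r)^-1%:C * y), y.
- by rewrite -conv_hull_vertices; exact: sub_conv_hull.
- by rewrite -conv_hull_vertices.
rewrite -conv_hull_vertices => Ft.
have : face A t z by rewrite -fcE.
have -> : t = omega + (n%:R * (t - omega)) / n%:R by field.
by have [k H] := Aface_sub_pos (n%:R * (t - omega)); exists k; apply: H => //.
Qed.

(** * The system of equations and its unique solution *)

Let nb0 : (0 < n * b)%N. Proof. by rewrite muln_gt0 n_gt0 b0. Qed.

Lemma Aface_idx (k : int) : Aface (pos (idx (n * b) k)%:Z) = Aface (pos k).
Proof.
rewrite /idx gez0_abs; last by apply: modz_ge0; rewrite gt_eqF.
by rewrite {2}(divz_eq k (n * b)%:Z) addrC mulrC Aface_pos_period.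
Qed.

Lemma ifs_map_modn (j : nat) z : ifs_map n w lam (j %% n) z = lam * z + digit j%:Z.
Proof.
by rewrite /ifs_map xi_digit [in RHS]digit_modn modz_nat absz_nat.
Qed.

Lemma ifs_mapS_modn (m : nat) z :
  ifs_map n w lam (m.+1 %% n) z = lam * z + digit (m%:Z + 1).
Proof. by rewrite ifs_map_modn -addn1. Qed.

(** This is [AfaceP] read on the grid: [pos (m * b)] is [m + 1/2], where digits [m] and [m + 1] tie,
    and strictly between two such indices [m + 1] is the only nearest integer. *)
Lemma solves_system_Aface :
  solves_system n b s (ifs_map n w lam) (fun j => Aface (pos j%:Z)).
Proof.
move=> m mn; rewrite !Aface_idx -!pos_shift; split.
  have posE : pos (m * b)%N%:Z = m%:Z%:~R + 2^-1.
    by rewrite /pos -[(m * b)%N%:Z%:~R]/((m * b)%N%:R) natrM mulfK// addrC.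
  have fm a : lam * a + digit m%:Z = ifs_map n w lam m a.
    by rewrite -ifs_map_modn modn_small.
  apply/seteqP; split=> z.
    move=> /AfaceP[j [a [+ Aa ->]]]; rewrite {1}posE => /nearest_half[->|->].
      by left; exists a.
    by right; exists a => //; rewrite ifs_mapS_modn.
  move=> [] [a Aa <-]; apply/AfaceP.
    exists m%:Z, a; rewrite fm; split => //.
    by rewrite posE; apply/nearest_half; left.
  exists (m%:Z + 1), a; rewrite ifs_mapS_modn; split => //.
  by rewrite posE; apply/nearest_half; right.
move=> k /andP[mk km]; rewrite Aface_idx -pos_shift.
have bk : m%:R * b%:R + 1 <= k%:R :> R by rewrite -natrM natr1 ler_nat.
have kb : k%:R + 1 <= (m%:R + 1) * b%:R :> R by rewrite !natr1 -natrM ler_nat.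
have kE : (k%:R / b%:R) * b%:R = k%:R :> R by rewrite divfK.
have h1 : m%:R < k%:R / b%:R :> R by rewrite ltr_pdivlMr//; lra.
have h2 : k%:R / b%:R < m%:R + 1 :> R by rewrite ltr_pdivrMr//; lra.
have near1 : `|(m.+1)%:Z%:~R - pos k%:Z| <= 2^-1.
  rewrite /pos -[k%:Z%:~R]/(k%:R) -[m.+1%:Z%:~R]/(m.+1%:R) -natr1 ler_norml.
  by apply/andP; split; lra.
apply/seteqP; split=> z.
  move=> /AfaceP[j [a [jx Aa ->]]]; exists a => //; rewrite ifs_map_modn.
  have [-> //|jm] := eqVneq j m.+1%:Z.
  have [i ik] := nearest_int_unique _ _ _ _ jm jx near1.
  have iE := half_pos _ _ ik; exfalso.
  have bz0 : 0 < b%:Z by rewrite ltz_nat.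
  have mi : m%:Z < i by rewrite -(ltr_pM2r bz0) -iE -PoszM ltz_nat.
  have im : i < m.+1%:Z by rewrite -(ltr_pM2r bz0) -iE -PoszM ltz_nat.
  by move: mi im; clear; lia.
move=> [a Aa <-]; apply/AfaceP; exists m.+1%:Z, a; split => //.
exact: ifs_map_modn.
Qed.

(** Puts the system in the form required by [contraction_subset]: the map that reaches [x] acts in
    the same way on every other solution [B']. *)
Lemma solves_systemP B : solves_system n b s (ifs_map n w lam) B ->
  forall k, (k < n * b)%N -> forall x, B k x -> exists i y,
    [/\ B (idx (n * b) (k%:Z - s)) y, x = lam * y + digit i &
    forall B', solves_system n b s (ifs_map n w lam) B' ->
      forall z, B' (idx (n * b) (k%:Z - s)) z -> B' k (lam * z + digit i)].
Proof.
move=> sB k kn x Bx; pose m := (k %/ b)%N.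
have mn : (m < n)%N by rewrite ltn_divLR.
have fm a : lam * a + digit m%:Z = ifs_map n w lam m a.
  by rewrite -ifs_map_modn modn_small.
have km : (k < m.+1 * b)%N by exact: ltn_ceil.
have : (m * b <= k)%N by exact: leq_divM.
rewrite leq_eqVlt => /orP[/eqP mk|mk].
  have := (sB m mn).1; rewrite mk => BE; move: Bx.
  rewrite BE => -[] [y By <-].
    exists m%:Z, y; split => // B' sB' z B'z.
    by have := (sB' m mn).1; rewrite mk => ->; left; exists z.
  exists m.+1%:Z, y; split; rewrite ?ifs_map_modn// => B' sB' z B'z.
  have := (sB' m mn).1; rewrite mk => ->; right; exists z => //.
  exact: ifs_map_modn.
have mkm : (m * b < k < m.+1 * b)%N by rewrite mk.
move: Bx; rewrite ((sB m mn).2 k mkm) => -[y By <-].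
exists m.+1%:Z, y; split; rewrite ?ifs_map_modn// => B' sB' z B'z.
rewrite ((sB' m mn).2 k mkm); exists z => //; exact: ifs_map_modn.
Qed.

Lemma nonempty_compacts_bounded N (B : nat -> set R[i]) :
  nonempty_compacts N B ->
  exists M, forall j, (j < N)%N -> forall z, B j z -> normc z <= M.
Proof.
elim: N => [_|N IH cB]; first by exists 0.
have [M HM] := IH (fun j jN => cB j (ltnW jN)).
have [M' HM'] := compact_normc_bounded _ (cB N (leqnn _)).2.
exists (Num.max M M') => j; rewrite ltnS leq_eqVlt => /orP[/eqP ->|jN] z Bz.
  by rewrite le_max (HM' z Bz) orbT.
by rewrite le_max (HM j jN z Bz).
Qed.

Lemma solves_system_sub B B' :
  nonempty_compacts (n * b) B -> nonempty_compacts (n * b) B' ->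
  solves_system n b s (ifs_map n w lam) B ->
  solves_system n b s (ifs_map n w lam) B' ->
  forall j, (j < n * b)%N -> B j `<=` B' j.
Proof.
move=> cB cB' sB sB' j jnb.
have [M HM] := nonempty_compacts_bounded _ _ cB.
have [M' HM'] := nonempty_compacts_bounded _ _ cB'.
have /andP[_ l1] := lam01.
apply: (@contraction_subset R 'I_(n * b) (fun i => B i) (fun i => B' i)
  (normc lam) (M + M') _ _ _ _ (Ordinal jnb)).
- by rewrite normc_ge0.
- move=> i x y /(HM i (ltn_ord i)) xM /(HM' i (ltn_ord i)) yM.
  by rewrite (le_trans (ler_normcD _ _))// normc_opp lerD.
- move=> i; have [? ?] := cB' i (ltn_ord i); split => //.
  exact: plane_compact_closed.
move=> i x /(solves_systemP _ sB _ (ltn_ord i))[m [y [By -> H]]].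
exists (Ordinal (modz_lt _ (i%:Z - s) nb0)), y, lam, (digit m); split => //.
exact: H.
Qed.

(* Away from the half-integers the digit is forced, so that distances within a
   face are multiplied by exactly [|lam|]. *)
Lemma Aface_pullback (m : int) (k : nat) : (k < b)%N -> forall x y,
  Aface (m%:~R + 2^-1 - n%:R * phi) x -> Aface (m%:~R + 2^-1 - n%:R * phi) y ->
  exists x' y', [/\ Aface (m%:~R + 2^-1 - k.+1%:R * (n%:R * phi)) x',
    Aface (m%:~R + 2^-1 - k.+1%:R * (n%:R * phi)) y' &
    normc (x - y) = normc lam ^+ k * normc (x' - y')].
Proof.
elim: k => [|k IH] kb x y Ax Ay.
  by exists x, y; rewrite !mul1r.
have [x' [y' [Ax' Ay' xy]]] := IH (ltnW kb) x y Ax Ay.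
have [|j jE] := Aface_no_half (m%:~R + 2^-1 - k.+1%:R * (n%:R * phi)).
  (* A half-integer here would force [b] to divide [k.+1 * s], hence [k.+1], which is positive and
     less than [b]. *)
  move=> i hi; have := half_pos (- k.+1%:Z * s) (i - m).
  rewrite /pos intrM intrB rmorphN /= -[k.+1%:Z%:~R]/(k.+1%:R) => hp.
  have /hp : 2^-1 + - k.+1%:R * s%:~R / b%:R = i%:~R - m%:~R + 2^-1 :> R.
    by move: hi; rewrite phis; lra.
  move=> e; have : (b%:Z %| k.+1%:Z * s)%Z.
    by rewrite -[_ * s]opprK -mulNr e -mulNr dvdz_mull.
  rewrite Gauss_dvdzl; last by rewrite coprimez_sym.
  by rewrite dvdzE /= => /dvdn_leq => /(_ isT); rewrite leqNgt kb.
move/jE : Ax' => [x2 Ax2 x2E]; move/jE : Ay' => [y2 Ay2 y2E].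
have eqS : m%:~R + 2^-1 - k.+2%:R * (n%:R * phi) =
    m%:~R + 2^-1 - k.+1%:R * (n%:R * phi) - n%:R * phi.
  by rewrite -[k.+2%:R]natr1; ring.
exists x2, y2; rewrite eqS; split => //.
rewrite xy x2E y2E opprD addrACA subrr addr0 -mulrBr normcM exprSr.
by rewrite mulrA.
Qed.

(** The distance between consecutive digits. *)
Let v := normc (cis_turn n%:R^-1 - 1) * normc w.

(** After [b] shifts a half-integer returns to a half-integer; [b.-1.+1] matches the form of
    [Aface_pullback]. *)
Lemma half_shift (m : int) : m%:~R + 2^-1 - b.-1.+1%:R * (n%:R * phi) =
  (m - s)%:~R + 2^-1.
Proof. by rewrite prednK// phis intrB; field. Qed.

(** One period of [b] shifts bounds a distance by [r] times a distance in another such face, plus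
    [v]. The bound is the fixed point of [D -> r * D + v], and the excess over it shrinks by [r] per
    period. *)
Lemma Aface_half_diam (m : int) x y :
  Aface (m%:~R + 2^-1) x -> Aface (m%:~R + 2^-1) y ->
  normc (x - y) <= v / (1 - r).
Proof.
have /andP[r0 r1] := ratio01.
have rN : 1 - r != 0 by rewrite subr_eq0 gt_eqF.
have v0 : 0 <= v by rewrite ltW// normc_digitS_sub_gt0.
have [M AM] := compact_normc_bounded _ compactA.
move=> Ax Ay; rewrite -subr_le0.
apply: (@expr_squeeze _ r (M + M)); first by rewrite r1 ltW.
move=> k; elim: k => [|k IH] in m x Ax y Ay *.
  rewrite expr0 mul1r lerBlDr (le_trans (ler_normcD _ _))// normc_opp -[leLHS]addr0.
  rewrite !lerD ?AM//; try exact: (sub_Aface _ _ Ax).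
    exact: (sub_Aface _ _ Ay).
  by rewrite divr_ge0// subr_ge0 ltW.
move/AfaceP : Ax => [i [a [/nearest_half im Aa ->]]].
move/AfaceP : Ay => [j [c [/nearest_half jm Ac ->]]].
have ijv : normc (digit i - digit j) <= v.
  case: im jm => -> [] ->; rewrite ?subrr ?normc0//.
    by rewrite normcBC normc_digitS_sub.
  by rewrite normc_digitS_sub.
have b1 : (b.-1 < b)%N by rewrite prednK.
have [a' [c' [+ + acE]]] := Aface_pullback m b.-1 b1 a c Aa Ac.
rewrite half_shift => Aa' Ac'; have := IH _ _ Aa' _ Ac' => {}IH.
have acr : normc (lam * (a - c)) = r * normc (a' - c').
  by rewrite normcM acE mulrA -exprS prednK.
rewrite opprD addrACA -mulrBr.
have h := ler_normcD (lam * (a - c)) (digit i - digit j).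
have h2 := ler_wpM2l (ltW r0) IH.
rewrite exprS -mulrA; apply: le_trans h2.
rewrite (mulrBr r) -acr.
have -> : r * (v / (1 - r)) = v / (1 - r) - v by field.
lra.
Qed.

(** The face at [2^-1] consists of two translates of [lam * X], at distance [v]. Convexity forbids a
    gap between them, so [lam * X] has diameter at least [v]; but that diameter is at most
    [r * v / (1 - r)]. *)
Lemma convex_ratio : is_convex A -> 2^-1 <= r.
Proof.
have /andP[r0 r1] := ratio01.
have rN : 0 < 1 - r by rewrite subr_gt0.
have v0 : 0 < v by exact: normc_digitS_sub_gt0.
move=> /(convex_face _ (omega + (0%:~R + 2^-1) / n%:R)) /is_convexP cF.
set X := Aface (0%:~R + 2^-1 - n%:R * phi).
have cX : compact X by exact: Aface_compact.
have X0 : X !=set0 by exact: Aface_neq0.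
set d := digit (0 + 1) - digit 0.
have dv : normc d = v by exact: normc_digitS_sub.
have cont : {within X, continuous (fun z => dot d (lam * z))}.
  rewrite (_ : (fun z => _) = dot (conjc lam * d)).
    by apply: continuous_subspaceT; exact: continuous_dot.
  by apply/funext => z; rewrite dot_mul.
have [p /set_mem Xp pmax] := compact_EVT_max X0 cX cont.
have [q /set_mem Xq qmin] := compact_EVT_min X0 cX cont.
have half01 : 0 <= (2^-1 : R) <= 1 by apply/andP; split; lra.
have Fp : Aface (0%:~R + 2^-1) (lam * p + digit 0).
  by apply/AfaceP; exists 0, p; split => //; apply/nearest_half; left.
have Fq : Aface (0%:~R + 2^-1) (lam * q + digit (0 + 1)).
  by apply/AfaceP; exists (0 + 1), q; split => //; apply/nearest_half; right.
(* The midpoint of the highest point of the first translate and the lowest of the second, along [d],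
   lies in one of the translates. In either case the second point is no higher than the first. *)
have := cF _ _ (2^-1) half01 Fp Fq.
move=> /AfaceP[i [a [/nearest_half i01 Aa midE]]].
have := congr1 (dot d) midE; rewrite dot_comb !dotD => {}midE.
have dd : dot d (digit (0 + 1)) - dot d (digit 0) = v ^+ 2.
  by rewrite -dotB dotxx dv.
have pa := pmax a (mem_set Aa); have qa := qmin a (mem_set Aa).
have vpq : v ^+ 2 <= dot d (lam * (p - q)).
  rewrite mulrBr dotB; case: i01 midE => -> midE; lra.
have {}vpq : v <= normc (lam * (p - q)).
  have := le_trans vpq (dot_le _ _); rewrite dv expr2.
  by rewrite ler_pM2l.
have b1 : (b.-1 < b)%N by rewrite prednK.
have [p' [q' [+ + pqE]]] := Aface_pullback 0 b.-1 b1 p q Xp Xq.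
rewrite half_shift => Ap' Aq'; have pq' := Aface_half_diam _ _ _ Ap' Aq'.
have pqr : normc (lam * (p - q)) = r * normc (p' - q').
  by rewrite normcM pqE mulrA -exprS prednK.
have := ler_wpM2l (ltW r0) pq'; rewrite -pqr => h.
have := le_trans vpq h; rewrite mulrCA -ler_pdivrMl// mulVf ?gt_eqF//.
by rewrite ler_pdivlMr//; lra.
Qed.

End Rational.

End Digits.

(** * Arithmetic of the parameters and proof of the theorem *)

Lemma alpha_inv (R : realType) (n : nat) (alpha : R) : (2 <= n)%N ->
  turn_arg (xi R n) alpha -> 0 <= alpha < 1 -> alpha = n%:R^-1.
Proof.
move=> n2; rewrite /turn_arg normE /xi normc_cis mul1r => /cis_turn_eqP na a01.
apply/esym; apply: eq_turn_inj01 na => //.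
by rewrite invr_ge0 ler0n invf_lt1 ?ltr0n ?ltr1n//; lia.
Qed.

(** With [n = n' * d] one has [q = b * d] and [s = n' * p]. Here [n'] is coprime to [b] because [d]
    is the gcd, and [p] is because [b] divides [q]. *)
Lemma rational_shift (R : realType) (n : nat) (phi : R) (p : int) (q b d : nat) :
  (0 < n)%N -> (0 < q)%N -> coprimez p q%:Z -> phi = p%:~R / q%:R ->
  (b * n)%N = lcmn n q -> d = gcdn n q ->
  let s := ((n%:Z * p) %/ d%:Z)%Z in
  [/\ (0 < b)%N, n%:R * phi = s%:~R / b%:R & coprimez s b%:Z].
Proof.
move=> n0 q0 pq phiE bn dE s.
have d0 : (0 < d)%N by rewrite dE gcdn_gt0 n0.
have b0 : (0 < b)%N.
  have : (0 < b * n)%N by rewrite bn lcmn_gt0 n0.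
  by rewrite muln_gt0 => /andP[].
have qE : q = (b * d)%N.
  apply/eqP; rewrite -(eqn_pmul2l n0) -(muln_lcm_gcd n q) -bn -dE.
  by rewrite mulnCA mulnA.
have /dvdnP[n' nE] : (d %| n)%N by rewrite dE dvdn_gcdl.
have sE : s = n'%:Z * p.
  by rewrite /s nE PoszM mulrAC mulzK// -lt0n.
split=> //.
  rewrite phiE sE nE qE intrM !natrM -[n'%:Z%:~R]/(n'%:R); field.
  by rewrite !pnatr_eq0 -!lt0n b0 d0.
rewrite sE coprimezMl; apply/andP; split.
  rewrite coprimezE !absz_nat /coprime -(eqn_pmul2r d0) mul1n.
  by rewrite muln_gcdl -nE -qE -dE.
by move: pq; rewrite qE PoszM coprimezMr => /andP[].
Qed.

(* The polygon of the points xi_n^j w has its sides at the angles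
   omega + (m + 1/2) alpha, where w has argument 2 pi omega: the angles of Theta
   are measured from the direction of w (one may take omega = 0 when w is a
   positive real). The angle alpha has to be the argument of xi_n in [0, 1[,
   not only modulo 1, since Theta involves half-integer multiples of it. *)
Theorem theorem3p2 (R : realType) (n : nat) (w lam : R[i]) (A : set R[i])
    (phi alpha omega : R)
    (hn : (2 <= n)%N)
    (hw : w != 0)
    (hlam : 0 < `|lam| < 1)
    (hA : is_attractor n (ifs_map n w lam) A)
    (hphi : turn_arg lam phi)
    (halpha : turn_arg (xi R n) alpha /\ 0 <= alpha < 1)
    (homega : turn_arg w omega) :
  (forall (p : int) (q b d : nat),
     (0 < q)%N -> coprimez p q%:Z -> phi = p%:~R / q%:R ->
     (b * n)%N = lcmn n q -> d = gcdn n q ->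
     let s := ((n%:Z * p) %/ d%:Z)%Z in
     let E := side_points b omega alpha A in
     [/\ [/\ is_polygon (conv_hull A),
             (side_angles (conv_hull A) #= `I_(n * b))%card &
             forall t : R, has_side (conv_hull A) t <->
               exists2 th, Theta n b phi alpha th & eq_turn t (omega + th)],
         [/\ extreme_points A = \bigcup_(j in `I_(n * b)) E j,
             nonempty_compacts (n * b) E,
             solves_system n b s (ifs_map n w lam) E &
             forall B : nat -> set R[i],
               nonempty_compacts (n * b) B ->
               solves_system n b s (ifs_map n w lam) B ->
               forall j : nat, (j < n * b)%N -> B j = E j] &
         is_convex A ->
           (2 `^ (- b%:R^-1))%:C <= `|lam| /\
           forall B : nat -> set R[i],
             nonempty_compacts (n * b) B ->
             solves_system n b s (ifs_map n w lam) B ->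
             boundary A = \bigcup_(j in `I_(n * b)) B j])
  /\
  (irrational phi ->
     ~ finite_set (side_angles (conv_hull A)) /\ ~ is_convex A).
Proof.
have lamN : 0 < normc lam < 1.
  by move: hlam; rewrite normE -[0]/(0%:C) -[1]/(1%:C) !ltcR.
have n0 : 0 < n%:R :> R by rewrite ltr0n ltnW.
have nN0 : n%:R != 0 :> R by rewrite gt_eqF.
have alphaE := alpha_inv _ _ _ hn halpha.1 halpha.2.
split; last first.
  move=> irr; split.
    exact: (infinite_sides_irrational n w lam A phi omega hn hw lamN hA hphi homega irr).
  exact: (not_convex_irrational n w lam A phi omega hn hw lamN hA hphi homega irr).
move=> p q b d q0 pq phiE bn dE s E.
have [|b0 phis cop] := rational_shift _ n phi p q b d _ q0 pq phiE bn dE;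
  first exact: ltnW.
rewrite -/s in phis cop.
have bN0 : b%:R != 0 :> R by rewrite pnatr_eq0 -lt0n.
have sideP := has_side_tie n w lam A phi omega hn hw lamN hA hphi homega.
have nb0 : (0 < n * b)%N by rewrite muln_gt0 b0 ltnW.
have tieP := tie_pos n phi b s b0 phis cop.
have extP := extreme_pointsP n w lam A phi omega hn hw lamN hA hphi homega b s b0 phis.
have idxE := Aface_idx n A omega hn b b0.
have sysF := solves_system_Aface n w lam A phi omega hn hw lamN hA hphi homega
  b s b0 phis.
(* As [alpha] is [1 / n], the [j]-th side is at the grid direction [pos b j], and a face of the hull
   meets [A] in the face of [A]. *)
have EE j : E j = Aface n A omega (pos b j%:Z).
  rewrite /E /side_points.
  have -> : omega + alpha / 2 + j%:R * alpha / b%:R = omega + pos b j%:Z / n%:R.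
    rewrite alphaE /pos -[j%:Z%:~R]/(j%:R); field.
    by rewrite nN0 bN0.
  apply/seteqP; split=> z.
    by move=> [[Az _] Fz]; rewrite /Aface -face_conv_hull.
  move=> Fz; split; first by apply/extP; exists j%:Z.
  exact: sub_face_conv_hull.
have {}EE : E = fun j => Aface n A omega (pos b j%:Z) by exact/funext.
have cE : nonempty_compacts (n * b) E.
  by rewrite EE => j _; split; [exact: Aface_neq0 hA _|exact: Aface_compact hA _].
have sE : solves_system n b s (ifs_map n w lam) E by rewrite EE.
have uniqE B : nonempty_compacts (n * b) B -> solves_system n b s (ifs_map n w lam) B ->
    forall j, (j < n * b)%N -> B j = E j.
  have sub := solves_system_sub n w lam hn lamN b s b0.
  by move=> cB sB j jnb; apply/seteqP; split; exact: sub.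
have extE : extreme_points A = \bigcup_(j in `I_(n * b)) E j.
  rewrite EE; apply/seteqP; split=> z.
    move=> /extP[k Fz]; exists (idx (n * b) k); last by rewrite idxE.
    exact: modz_lt.
  by move=> [j _ Fz]; apply/extP; exists j%:Z.
have hullE := conv_hull_vertices n w lam A phi hn lamN hA hphi b s b0 phis.
split; last 1 first.
- move=> cA; split.
    rewrite normE lecR; have /andP[l0 _] := lamN.
    (* Raising to the power [b] reduces the bound to [convex_ratio]. *)
    rewrite -(ler_pXn2r b0) ?nnegrE ?powR_ge0 ?(ltW l0)//.
    rewrite -powR_mulrn ?powR_ge0// -powRrM mulNr mulVf// powRN powRr1//.
    exact: (convex_ratio n w lam A phi omega hn hw lamN hA hphi homega b s b0 phis cop cA).
  move=> B cB sB.
  have -> : \bigcup_(j in `I_(n * b)) B j = \bigcup_(j in `I_(n * b)) E j.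
    by apply: eq_bigcupr => j jnb; exact: uniqE.
  (* A convex [A] is its own hull, and being closed it contains its boundary. *)
  rewrite -extE /extreme_points (conv_hull_id _ cA).
  have clA : closed A by apply: plane_compact_closed; case: hA.
  apply/esym/setIidPr => z [Az _].
  by rewrite (closure_id A).1.
- split.
  + exists (vertices n w lam b); split => //.
    exact: (finite_vertices n w lam hn b).
  (* Two grid directions agree modulo 1 exactly when [n * b] divides the difference of their
     indices, so reduction to [[0, 1[] is a bijection from the indices below [n * b] to the side
     angles. *)
  + pose ang k := omega + pos b k / n%:R.
    have angE i j : eq_turn (ang i) (ang j) <-> exists K, i - j = K * (n * b)%:Z.
      have ijE : ang i - ang j = (i - j)%:~R / (n * b)%:R.
        by rewrite intrB natrM /ang /pos; field; rewrite nN0 bN0.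
      have nbN0 : (n * b)%:R != 0 :> R by rewrite pnatr_eq0 -lt0n.
      rewrite /eq_turn ijE; split=> -[K KE]; exists K.
        apply/eqP; rewrite -(eqr_int R) intrM -[(n * b)%:Z%:~R]/((n * b)%:R) -KE.
        by rewrite divfK.
      by rewrite KE intrM mulfK.
    have /choice[h hE] j : exists t, (0 <= t < 1) /\ eq_turn (ang j%:Z) t.
      by have [t t01 et] := eq_turn_frac (ang j%:Z); exists t.
    have sideE : side_angles (conv_hull A) = h @` `I_(n * b).
      apply/seteqP; split=> t.
        move=> [t01 /sideP/tieP[k kE]]; exists (idx (n * b) k); first exact: modz_lt.
        have [h01 he] := hE (idx (n * b) k).
        apply: eq_turn_inj01 => //.
        have -> : t = ang k by rewrite /ang -kE; field.
        have /cis_turn_eqP kk : eq_turn (ang (idx (n * b) k)%:Z) (ang k).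
          apply/angE; exists (- (k %/ (n * b)%:Z)%Z).
          rewrite /idx gez0_abs; last by apply: modz_ge0; rewrite gt_eqF.
          by rewrite {2}(divz_eq k (n * b)%:Z) opprD addrCA subrr addr0 mulNr.
        by apply/cis_turn_eqP; rewrite -kk; apply/cis_turn_eqP/eq_turn_sym.
      move=> [j _ <-]; have [h01 he] := hE j; split => //.
      rewrite /has_side -(face_eq_turn _ _ _ he); apply/sideP/tieP.
      by exists j%:Z; rewrite /ang; field.
    rewrite sideE; apply: inj_card_eq => i j; rewrite !inE /= => inb jnb hij.
    have [_ /cis_turn_eqP ei] := hE i; have [_ /cis_turn_eqP ej] := hE j.
    have /cis_turn_eqP/angE[K KE] := etrans (etrans ei (congr1 _ hij)) (esym ej).
    have K0 : K = 0.
      have nbz : 0 < (n * b)%:Z by [].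
      have l1 : K * (n * b)%:Z < 1 * (n * b)%:Z by rewrite -KE mul1r;
        move: inb jnb; clear; lia.
      have l2 : -1 * (n * b)%:Z < K * (n * b)%:Z by rewrite -KE mulN1r;
        move: inb jnb; clear; lia.
      by move: l1 l2; rewrite !ltr_pM2r//; clear; lia.
    by move: KE; rewrite K0 mul0r => /eqP; rewrite subr_eq0 => /eqP[].
  + move=> t; rewrite sideP; split.
      move=> [k [m kE]].
      (* Each block of [b] shifts adds the integer [s], which goes into [m1]; reducing [m1] modulo
         [n] then changes the angle by whole turns. *)
      set c := (k %/ b)%N; set k' := (k %% b)%N.
      set m1 := m + c%:Z * s.
      exists (k'%:R * phi + (`|(m1 %% n%:Z)%Z|%N%:R + 2^-1) * alpha).
        exists k', `|(m1 %% n%:Z)%Z|%N; split => //; first exact: ltn_pmod.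
        exact: modz_lt (ltnW hn).
      exists (m1 %/ n%:Z)%Z.
      rewrite -[`|_|%N%:R]/(`|_|%N%:Z%:~R) gez0_abs;
        last by rewrite modz_ge0// eqz_nat -lt0n ltnW.
      have m1E : m1%:~R = (m1 %/ n%:Z)%Z%:~R * n%:R + (m1 %% n%:Z)%Z%:~R :> R.
        by rewrite {1}(divz_eq m1 n%:Z) intrD intrM.
      have kR : k%:R = c%:R * b%:R + k'%:R :> R by rewrite -natrM -natrD -divn_eq.
      have m1R : m1%:~R = m%:~R + c%:R * s%:~R :> R by rewrite /m1 intrD intrM.
      have sR : s%:~R = b%:R * (n%:R * phi) by rewrite phis mulrCA divff// mulr1.
      have tE : t = omega + (k%:R * (n%:R * phi) + m%:~R + 2^-1) / n%:R.
        by rewrite -kE; field.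
      rewrite tE alphaE kR.
      apply: (mulIf nN0); rewrite (_ : (m1 %/ n)%Z%:~R * _ = m1%:~R - (m1 %% n%:Z)%Z%:~R).
        rewrite m1R sR; field; exact: nN0.
      by rewrite m1E addrK.
    move=> [_ [k [m [kb mn ->]]] [K tE]]; exists k, (m%:Z + n%:Z * K).
    have -> : t = omega + (k%:R * phi + (m%:R + 2^-1) * alpha) + K%:~R.
      by rewrite -tE; ring.
    rewrite alphaE intrD intrM -[m%:Z%:~R]/(m%:R) -[n%:Z%:~R]/(n%:R); field.
    exact: nN0.
by split.
Qed.
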